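(* Under the $\infty$-Wasserstein ambiguity set $\mathcal P_\infty^W$, with $\bar g_i(x,\zeta):=\max_{\xi\in\Xi}\{g_i(x,\xi):\|\xi-\zeta\|\le\theta\}$ for $i\in[I]$: (i) the worst-case ALSO-X $$v_\infty^A=\min_t\ t\ \text{ s.t. }\ x^*\in\operatorname*{argmin}_{x\in\mathcal X}\Big\{\sup_{\mathbb P\in\mathcal P_\infty^W}\mathbb E_{\mathbb P}\Big[\max_{i\in[I]}g_i(x,\tilde\xi)_+\Big]:c^\top x\le t\Big\},\quad\inf_{\mathbb P\in\mathcal P_\infty^W}\mathbb P\{g_i(x^*,\tilde\xi)\le0,\forall i\in[I]\}\ge1-\varepsilon$$ is equivalent to $$v_\infty^A=\min_t\ t\ \text{ s.t. }\ x^*\in\operatorname*{argmin}_{x\in\mathcal X}\Big\{\mathbb E_{\mathbb P_{\tilde\zeta}}\Big[\max_{i\in[I]}\bar g_i(x,\tilde\zeta)_+\Big]:c^\top x\le t\Big\},\quad\mathbb P_{\tilde\zeta}\{\bar g_i(x^*,\tilde\zeta)\le0,\ \forall i\in[I]\}\ge1-\varepsilon;$$ (ii) the worst-case CVaR approximation $$v_\infty^{\mathrm{CVaR}}=\min_{x\in\mathcal X}\Big\{c^\top x:\ \sup_{\mathbb P\in\mathcal P_\infty^W}\inf_\beta\Big[\beta+\tfrac1\varepsilon\mathbb E_{\mathbb P}\big[\max_{i\in[I]}(g_i(x,\tilde\xi)-\beta)_+\big]\Big]\le0\Big\}$$ is equivalent to $$v_\infty^{\mathrm{CVaR}}=\min_{x\in\mathcal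 X}\Big\{c^\top x:\ \min_\beta\Big[\beta+\tfrac1\varepsilon\mathbb E_{\mathbb P_{\tilde\zeta}}\big[\big(\max_{i\in[I]}\bar g_i(x,\tilde\zeta)-\beta\big)_+\big]\Big]\le0\Big\}.$$
   Context: Setting. $\Xi\subseteq\mathbb R^m$, $\varepsilon\in(0,1)$, $c\in\mathbb R^n$, $\theta\ge0$. Assumptions: each $g_i:\mathbb R^n\times\Xi\to\mathbb R$ ($i\in[I]$) is convex and lower semicontinuous in $x$; $\mathcal X\subseteq\mathbb R^n$ is nonempty, closed, convex and contained in a closed pointed convex cone. The reference distribution $\mathbb P_{\tilde\zeta}$ (law of $\tilde\zeta$ on $\Xi$) is sub-Gaussian: $\mathbb P_{\tilde\zeta}\{\|\tilde\zeta\|\ge r\}\le C_1\exp(-C_2r^2)$ for some constants $C_1,C_2>0$. It is taken for granted that the $\bar g_i$ are well-defined real-valued functions (the maxima are attained). Ambiguity set: $\mathcal P_\infty^W=\{\mathbb P:\ \mathbb P\{\tilde\xi\in\Xi\}=1,\ W_\infty(\mathbb P,\mathbb P_{\tilde\zeta})\le\theta\}$, where $W_\infty(\mathbb P_1,\mathbb P_2)$ is the infimum, over joint distributions $\mathbb Q$ with marginals $\mathbb P_1,\mathbb P_2$, of the $\mathbb Q$-essential supremum of $\|\xi_1-\xi_2\|$. *)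

(* Defs.v *)
From HB Require Import structures.
From mathcomp Require Import all_boot all_order all_algebra.
From mathcomp Require Import all_classical all_reals all_analysis.
From mathcomp Require Import ess_sup_inf.

Set Implicit Arguments.
Unset Strict Implicit.
Unset Printing Implicit Defensive.

Import Order.TTheory GRing.Theory Num.Theory.
Import numFieldNormedType.Exports.

Local Open Scope classical_set_scope.
Local Open Scope ring_scope.

(* R^m with its Borel sigma-algebra; the carrier is convertible to 'rV[R]_m. *)
Definition borelV (R : realType) (m : nat) :=
  g_sigma_algebraType (@open 'rV[R]_m).

Definition dotv (R : realType) (n : nat) (c x : 'rV[R]_n) : R :=
  \sum_(j < n) c 0 j * x 0 j.

(* The reference norm is arbitrary; the library norm of 'rV[R]_m is the sup
   norm and is only used through the topology it induces. *)
Definition is_norm (R : realType) (m : nat) (N : 'rV[R]_m -> R) : Prop :=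
  [/\ forall u, N u = 0 -> u = 0,
      forall (a : R) u, N (a *: u) = `|a| * N u
    & forall u v, N (u + v) <= N u + N v].

Definition closed_pointed_convex_cone (R : realType) (n : nat)
    (K : set 'rV[R]_n) : Prop :=
  [/\ closed K,
      convex_set (K : set (convex_lmodType 'rV[R]_n)),
      forall (a : R) x, 0 <= a -> K x -> K (a *: x)
    & forall x, K x -> K (- x) -> x = 0].

Section wasserstein.
Context (R : realType) (m : nat) (N : 'rV[R]_m -> R).
Local Open Scope ereal_scope.

Definition coupling (P1 P2 : probability (borelV R m) R) :
    set (probability (borelV R m * borelV R m)%type R) :=
  [set Q | (forall A : set (borelV R m), measurable A ->
              Q (A `*` setT) = P1 A) /\
           (forall A : set (borelV R m), measurable A ->
              Q (setT `*` A) = P2 A)].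

Definition wasserstein_infty (P1 P2 : probability (borelV R m) R) : \bar R :=
  ereal_inf [set ess_sup Q
      (fun p : borelV R m * borelV R m =>
         (N ((p.1 : 'rV[R]_m) - (p.2 : 'rV[R]_m)))%:E)
    | Q in coupling P1 P2].

Definition ambiguity_set (Xi : set 'rV[R]_m) (Pz : probability (borelV R m) R)
    (theta : R) : set (probability (borelV R m) R) :=
  [set P : probability (borelV R m) R | P Xi = 1 /\ wasserstein_infty P Pz <= theta%:E].

End wasserstein.

Section chance_constraint.
Context (R : realType) (n m I : nat) (Xi : set 'rV[R]_m).
Implicit Types (g : 'I_I -> 'rV[R]_n -> 'rV[R]_m -> R)
  (P : probability (borelV R m) R) (A : set (probability (borelV R m) R))
  (x : 'rV[R]_n) (beta eps : R).

(* Under the attainment hypothesis made in the statement, this [sup] is the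
   maximum of g_i(x, .) over Xi intersected with the closed ball. *)
Definition gbar (N : 'rV[R]_m -> R) (theta : R) g (i : 'I_I) x
    (zeta : 'rV[R]_m) : R :=
  sup [set g i x xi | xi in [set xi | Xi xi /\ N (xi - zeta) <= theta]].

Local Open Scope ereal_scope.

(* Functions of the uncertain parameter are only meaningful on Xi, which has
   full measure for every distribution considered: expectations are integrals
   over Xi and events are subsets of Xi. *)
Definition hinge_loss g P x : \bar R :=
  \int[P]_(xi in Xi) \big[maxe/-oo]_(i < I) (Num.max (g i x xi) 0)%:E.

Definition safe_prob g P x : \bar R :=
  P [set xi : borelV R m | Xi xi /\ forall i : 'I_I, (g i x xi <= 0)%R].

Definition worst_hinge_loss g A x : \bar R :=
  ereal_sup [set hinge_loss g P x | P in A].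

Definition worst_safe_prob g A x : \bar R :=
  ereal_inf [set safe_prob g P x | P in A].

(* beta + E_P[max_i (g_i - beta)_+] / eps *)
Definition cvar_obj_max_pos eps g P x beta : \bar R :=
  beta%:E + eps^-1%:E *
    \int[P]_(xi in Xi) \big[maxe/-oo]_(i < I) (Num.max (g i x xi - beta) 0)%:E.

(* beta + E_P[(max_i g_i - beta)_+] / eps *)
Definition cvar_obj_pos_max eps g P x beta : \bar R :=
  beta%:E + eps^-1%:E *
    \int[P]_(xi in Xi)
      maxe (\big[maxe/-oo]_(i < I) (g i x xi)%:E - beta%:E) 0.

Definition worst_cvar eps g A x : \bar R :=
  ereal_sup [set ereal_inf (range (cvar_obj_max_pos eps g P x)) | P in A].

(* min_beta (h beta) <= 0, where the minimum is required to be attained. *)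
Definition min_le0 (h : R -> \bar R) : Prop :=
  exists2 beta, (forall b, h beta <= h b) & h beta <= 0.

End chance_constraint.

Section programs.
Context (R : realType) (n : nat) (X : set 'rV[R]_n) (c : 'rV[R]_n).
Local Open Scope ereal_scope.

Definition argmin_set (F : 'rV[R]_n -> \bar R) (t : R) : set 'rV[R]_n :=
  [set x | [/\ X x, (dotv c x <= t)%R
    & forall y, X y -> (dotv c y <= t)%R -> F x <= F y]].

(* Feasible pairs (t, x^* ) of the ALSO-X program with lower-level objective F
   and chance constraint p x >= 1 - eps. *)
Definition alsox_feasible (eps : R) (F p : 'rV[R]_n -> \bar R) :
    set (R * 'rV[R]_n) :=
  [set tx | argmin_set F tx.1 tx.2 /\ (1 - eps)%:E <= p tx.2].

(* Optimal values are infima in [-oo, +oo]; +oo means infeasible. *)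
Definition alsox_value (S : set (R * 'rV[R]_n)) : \bar R :=
  ereal_inf [set tx.1%:E | tx in S].

Definition linear_value (S : set 'rV[R]_n) : \bar R :=
  ereal_inf [set (dotv c x)%:E | x in S].

End programs.

(* Main.v *)
(* For a real-valued loss f on Xi whose maximum fb z over each ball of radius
   theta is attained, everything follows from comparing the law of f under
   distributions of the ambiguity set with the law of fb under Pz.

   Upper bound: a coupling with essential supremum at most theta + e gives
   P K <= Pz (K thickened by theta + e) for closed K; letting e tend to 0 and
   approximating Borel sets from inside by closed ones gives
   P (f > a) <= Pz (fb > a), hence the bound on all integrals.

   Lower bound: for every d > 0 there is a measurable T moving points by at most
   theta with f (T z) >= fb z - d almost surely.  The level set f >= j d is only
   Borel, but by Choquet's capacitability theorem countably many of its closed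
   subsets K have thickenings exhausting fb >= j d up to a Pz-null set, and on
   the thickening of a closed K a nearby point of K can be chosen measurably.
   The law of T then nearly attains all worst cases simultaneously, which also
   settles the exchange of sup over P and inf over beta in the CVaR. *)

Require Import Defs.
From HB Require Import structures.
From mathcomp Require Import all_boot all_order all_algebra.
From mathcomp Require Import all_classical all_reals all_analysis.
From mathcomp Require Import ess_sup_inf measurable_realfun.
From mathcomp Require Import ring lra.

Set Implicit Arguments.
Unset Strict Implicit.
Unset Printing Implicit Defensive.

Import Order.TTheory GRing.Theory Num.Theory.
Import numFieldNormedType.Exports.

Local Open Scope classical_set_scope.
Local Open Scope ring_scope.

(** * Norms and thickenings in finite dimension *)

(** Cantor's intersection theorem: the [C n] generate a proper filter containing [A], and a cluster
    point of it lies in every closed [C n]. *)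
Lemma nested_compact (T : topologicalType) (A : set T) (C : nat -> set T) :
  compact A -> (forall n, closed (C n)) -> (forall n, C n `<=` A) ->
  (forall n, C n.+1 `<=` C n) -> (forall n, C n !=set0) ->
  exists x, forall n, C n x.
Proof.
move=> cA clC CA Cd C0.
have Cm i j : (i <= j)%N -> C j `<=` C i.
  by move=> /subnK <-; elim: (j - i)%N => // k IH x /Cd /IH.
have FF : Filter (filter_from [set: nat] C).
  apply: filter_fromT_filter; first by exists 0%N.
  move=> i j; exists (maxn i j) => x Cx.
  by split; apply: Cm Cx; rewrite ?leq_maxl ?leq_maxr.
have PF := filter_from_proper FF (fun i _ => C0 i).
have FA : filter_from [set: nat] C A by exists 0%N => //; exact: CA.
have [x [_ clx]] := cA _ PF FA; exists x => n.
apply: clC => B /clx; apply; exact: in_filter_from.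
Qed.

Section norm.
Context (R : realType) (m : nat) (N : 'rV[R]_m -> R) (N_norm : is_norm N).
Implicit Types (x y z u v : 'rV[R]_m) (E K L : set 'rV[R]_m).

Lemma is_norm0 : N 0 = 0.
Proof. by case: N_norm => _ NZ _; rewrite -(scale0r 0) NZ normr0 mul0r. Qed.

Lemma is_normN x : N (- x) = N x.
Proof. by case: N_norm => _ NZ _; rewrite -scaleN1r NZ normrN1 mul1r. Qed.

Lemma is_norm_ge0 x : 0 <= N x.
Proof.
case: N_norm => _ _ NT; have := NT x (- x).
by rewrite subrr is_norm0 is_normN -mulr2n pmulrn_lge0.
Qed.

Lemma is_normB x y : N (x - y) = N (y - x).
Proof. by rewrite -is_normN opprB. Qed.

Lemma is_norm_split z x y : N (x - y) <= N (x - z) + N (z - y).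
Proof. by case: N_norm => _ _ NT; apply: le_trans (NT _ _); rewrite addrA subrK. Qed.

Lemma is_norm_dist x y : `|N x - N y| <= N (x - y).
Proof.
case: N_norm => _ _ NT; rewrite ler_norml; apply/andP; split.
  rewrite lerNl opprB lerBlDr is_normB; apply: le_trans (NT _ _).
  by rewrite subrK.
by rewrite lerBlDr; apply: le_trans (NT _ _); rewrite subrK.
Qed.

Lemma is_norm_le_norm : exists2 M : R, 0 < M & forall x, N x <= M * `|x|.
Proof.
have NT : forall u v, N (u + v) <= N u + N v by case: N_norm.
have NZ : forall a u, N (a *: u) = `|a| * N u by case: N_norm.
(* The summand 1 keeps the constant positive when [m] is 0. *)
exists (1 + \sum_(j < m) N (delta_mx 0 j)).
  by rewrite ltr_pwDl// sumr_ge0// => j _; exact: is_norm_ge0.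
move=> x; rewrite {1}(row_sum_delta x).
apply: (@le_trans _ _ (\sum_(j < m) N (x 0 j *: delta_mx 0 j))).
  elim/big_ind2 : _ => [|? ? ? ? h1 h2|//]; first by rewrite is_norm0.
  by apply: (le_trans (NT _ _)); exact: lerD.
rewrite mulrDl mul1r ler_wpDl// mulr_suml ler_sum// => j _.
rewrite NZ mulrC ler_wpM2l ?is_norm_ge0//.
rewrite /Num.norm/= mx_normrE.
by rewrite (le_bigmax _ (fun ij => `|x ij.1 ij.2|) (0, j)).
Qed.

Lemma is_norm_continuous : continuous N.
Proof.
have [M M0 NM] := is_norm_le_norm => x.
apply/(@cvgrPdist_lt _ _ _ (nbhs x)) => e e0.
have : nbhs x [set y | `|x - y| < e / M].
  by rewrite -filter_from_norm_nbhs; exists (e / M) => //=; exact: divr_gt0.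
apply: filterS => y xy; apply: (le_lt_trans (is_norm_dist _ _)).
by apply: (le_lt_trans (NM _)); rewrite mulrC -ltr_pdivlMr.
Qed.

(** By compactness [N] has a minimum on the unit sphere of the library norm; it is positive by
    definiteness, and its inverse is the constant. *)
Lemma norm_le_is_norm : exists2 M : R, 0 < M & forall x, `|x| <= M * N x.
Proof.
pose S := [set x : 'rV[R]_m | `|x| = 1].
have NZ : forall a u, N (a *: u) = `|a| * N u by case: N_norm.
(* The sphere is empty only in dimension 0, where every vector is 0. *)
have [S0|/set0P S0] := eqVneq S set0.
  exists 1 => // x; have [->|x0] := eqVneq x 0; first by rewrite normr0 mul1r is_norm_ge0.
  have : S (`|x|^-1 *: x).
    by rewrite /S/= normrZ normfV normr_id mulVf// normr_eq0.
  by rewrite S0.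
have cS : compact S.
  apply: bounded_closed_compact.
    by exists 1; split => // e e1 x /= ->; exact: ltW.
  have -> : S = (@Num.norm R _) @^-1` [set (1 : R)] by [].
  by apply: preimage_closed; [move=> ? _; exact: norm_continuous|exact: closed_eq].
have [u] := EVT_min_rV S0 cS (continuous_subspaceT is_norm_continuous).
rewrite inE => Su umin.
have Nu0 : 0 < N u.
  rewrite lt_def is_norm_ge0 andbT; apply/eqP => Nu.
  have u0 : u = 0 by case: N_norm => + _ _; apply.
  by move: Su; rewrite /S/= u0 normr0 => /esym/eqP; rewrite oner_eq0.
exists (N u)^-1 => [|x]; first by rewrite invr_gt0.
have [->|x0] := eqVneq x 0; first by rewrite normr0 is_norm0 mulr0.
rewrite mulrC ler_pdivlMr// mulrC -ler_pdivlMr ?normr_gt0//.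
have := umin (`|x|^-1 *: x); rewrite inE NZ normfV normr_id mulrC; apply.
by rewrite /S/= normrZ normfV normr_id mulVf// normr_eq0.
Qed.

Lemma is_norm_nbhs x (U : set 'rV[R]_m) : nbhs x U ->
  exists2 e : R, 0 < e & forall y, N (y - x) < e -> U y.
Proof.
have [M M0 MN] := norm_le_is_norm.
rewrite -filter_from_norm_nbhs => -[e /= e0 eU]; exists (e / M) => [|y yx]; first exact: divr_gt0.
apply: eU => /=; rewrite distrC; apply: (le_lt_trans (MN _)).
by rewrite mulrC -ltr_pdivlMr.
Qed.

Lemma nbhs_is_norm x (e : R) : 0 < e -> \forall y \near x, N (y - x) < e.
Proof.
have [M M0 NM] := is_norm_le_norm.
move=> e0; have : nbhs x [set y | `|x - y| < e / M].
  by rewrite -filter_from_norm_nbhs; exists (e / M) => //=; exact: divr_gt0.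
apply: filterS => y xy; rewrite is_normB.
by apply: (le_lt_trans (NM _)); rewrite mulrC -ltr_pdivlMr.
Qed.

Lemma is_norm_ball_closed z (r : R) : closed [set x | N (x - z) <= r].
Proof.
have -> : [set x | N (x - z) <= r] = (fun x => N (x - z)) @^-1` [set y | y <= r] by [].
apply: preimage_closed; last exact: closed_le.
move=> x _; apply: (@cvg_comp _ _ _ (fun x => x - z) N _ (nbhs (x - z))); last first.
  exact: is_norm_continuous.
by apply: (@cvgB _ _ _ (nbhs x) _ id (cst z)); [exact|exact: cvg_cst].
Qed.

Lemma is_norm_ball_compact z (r : R) : compact [set x | N (x - z) <= r].
Proof.
apply: bounded_closed_compact; last exact: is_norm_ball_closed.
have [M M0 MN] := norm_le_is_norm.
exists (M * r + `|z|); split; first exact: num_real.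
move=> e er x /= xz; apply: le_trans (ltW er).
rewrite -[x in `|x|](subrK z); apply: (le_trans (ler_normD _ _)).
by rewrite lerD2r; apply: (le_trans (MN _)); rewrite ler_pM2l.
Qed.

Lemma rat_dense x (e : R) : 0 < e ->
  exists q : 'rV[rat]_m, N (x - map_mx ratr q) < e.
Proof.
have [M M0 NM] := is_norm_le_norm => e0.
have d0 : 0 < e / M / 2 by rewrite !divr_gt0.
have /choice[q qP] : forall j : 'I_m, exists a : rat, `|x 0 j - ratr a| <= e / M / 2.
  move=> j; have /rat_in_itvoo[a] : x 0 j < x 0 j + e / M / 2 by rewrite ltrDl.
  rewrite in_itv/= => /andP[a1 a2]; exists a.
  by rewrite distrC ger0_norm ?subr_ge0 ?(ltW a1)// lerBlDl ltW.
exists (\row_j q j); apply: (le_lt_trans (NM _)).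
rewrite mulrC -ltr_pdivlMr//.
apply: (@le_lt_trans _ _ (e / M / 2)); last first.
  by rewrite ltr_pdivrMr// mulr_natr mulr2n ltrDl divr_gt0.
rewrite /Num.norm/= mx_normrE; apply: bigmax_le; first exact: ltW.
by case=> i j _ /=; rewrite !mxE ord1; exact: qP.
Qed.

(** The near point must belong to [E] itself, so for a set that is not closed this can be smaller
    than the set of points at distance at most [r]. *)
Definition thicken (r : R) E : set 'rV[R]_m :=
  [set z | exists2 x, E x & N (x - z) <= r].

Lemma thickenS (r : R) E E' : E `<=` E' -> thicken r E `<=` thicken r E'.
Proof. by move=> EE' z [x /EE' ? ?]; exists x. Qed.

Lemma thicken0 E : thicken 0 E = E.
Proof.
apply/seteqP; split => [z [x Ex xz]|z Ez]; last by exists z => //; rewrite subrr is_norm0.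
have /eqP : N (x - z) = 0 by apply/eqP; rewrite eq_le xz is_norm_ge0.
move=> /eqP; have [N0 _ _] := N_norm => /N0/eqP.
by rewrite subr_eq0 => /eqP <-.
Qed.

(** The points of [K] within [r + 1/(n+1)] of [z] form nested nonempty compact sets; a common point
    is within [r]. *)
Lemma bigcap_thicken_radius (r : R) K z : closed K ->
  (forall n, thicken (r + n.+1%:R^-1) K z) -> thicken r K z.
Proof.
move=> clK h.
pose C n := K `&` [set x | N (x - z) <= r + n.+1%:R^-1].
have [||||x Cx] := @nested_compact _ _ C (@is_norm_ball_compact z (r + 1)).
- by move=> n; apply: closedI => //; exact: is_norm_ball_closed.
- by move=> n x [_ /= /le_trans]; apply; rewrite lerD2l invf_le1// ler1n.
- move=> n x [Kx /= xz]; split => //=; apply: (le_trans xz).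
  by rewrite lerD2l lef_pV2 ?posrE// ler_nat.
- by move=> n; have [x Kx xz] := h n; exists x.
- exists x; first by case: (Cx 0%N).
  apply/ler_addgt0Pr => e e0.
  have [n] := ltr_add_invr e0; rewrite add0r => ne.
  by case: (Cx n) => _ /= /le_trans; apply; rewrite lerD2l ltW.
Qed.

Lemma closed_thicken (r : R) K : closed K -> closed (thicken r K).
Proof.
move=> clK z zK; apply: bigcap_thicken_radius => // n.
have n0 : 0 < (n.+1%:R^-1 : R) by rewrite invr_gt0.
have [y [[x Kx xy] yz]] := zK _ (nbhs_is_norm z n0).
by exists x => //; apply: (le_trans (is_norm_split y _ _)); rewrite lerD// ltW.
Qed.

(** Compactness of balls gives a near point common to all [L n]. This is the continuity along
    decreasing closed sets that a capacity must have. *)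
Lemma bigcap_thicken (r : R) (L : nat -> set 'rV[R]_m) :
  (forall n, closed (L n)) -> (forall n, L n.+1 `<=` L n) ->
  \bigcap_n thicken r (L n) `<=` thicken r (\bigcap_n L n).
Proof.
move=> clL Ld z h.
pose C n := L n `&` [set x | N (x - z) <= r].
have [||||x Cx] := @nested_compact _ _ C (@is_norm_ball_compact z r).
- by move=> n; apply: closedI => //; exact: is_norm_ball_closed.
- by move=> n x [].
- by move=> n x [Lx xz]; split => //; exact: Ld.
- by move=> n; have [x Lx xz] := h n I; exists x.
- by exists x; [move=> n _; case: (Cx n) | case: (Cx 0%N)].
Qed.

End norm.

(** * Suslin sets and capacitability *)

Lemma seq_dependent_choice (Q : seq nat -> Prop) : Q [::] ->
  (forall s, Q s -> exists v, Q (rcons s v)) ->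
  exists f : nat -> nat, forall n, Q (mkseq f n).
Proof.
move=> Q0 QS.
have /choice[h hP] : forall s, exists v, Q s -> Q (rcons s v).
  by move=> s; have [/QS[v ?]|?] := pselect (Q s); [exists v|exists 0%N].
pose t n := iter n (fun s => rcons s (h s)) [::].
have tE n : mkseq (h \o t) n = t n by elim: n => // n IH; rewrite mkseqS IH.
by exists (h \o t) => n; rewrite tE; elim: n => //= n IH; exact: hP.
Qed.

Lemma mkseqSl (T : Type) (f : nat -> T) n :
  mkseq f n.+1 = f 0%N :: mkseq (f \o S) n.
Proof. by rewrite /mkseq /= -[1%N]addn0 iotaDl -map_comp. Qed.

Section suslin.
Context (T : topologicalType).
Implicit Types (E C : set T) (F : seq nat -> set T) (f : nat -> nat).

(** Suslin's operation applied to closed sets indexed by finite sequences; [mkseq f n] is the prefix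
    of length [n] of the branch [f]. *)
Definition suslin E := exists2 F : seq nat -> set T, forall s, closed (F s) &
  E = [set x | exists f, forall n, F (mkseq f n) x].

Lemma suslin_closed C : closed C -> suslin C.
Proof.
move=> clC; exists (fun=> C) => //; apply/seteqP; split => [x Cx|x [f /(_ 0%N)]//].
by exists id.
Qed.

(** The first entry of a branch selects the set [E n], the remaining entries form a branch for
    it. *)
Lemma suslin_bigcup (E : nat -> set T) :
  (forall n, suslin (E n)) -> suslin (\bigcup_n E n).
Proof.
move=> Esus.
have /choice[F FP] : forall n, exists F : seq nat -> set T,
    (forall s, closed (F s)) /\ E n = [set x | exists f, forall k, F (mkseq f k) x].
  by move=> n; have [F ? ?] := Esus n; exists F.
exists (fun s => if s is v :: s' then F v s' else setT).
  by case => [|v s]; [exact: closedT|exact: (FP v).1].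
apply/seteqP; split=> [x [n _]|x [f fx]].
  rewrite (FP n).2 => -[f fx]; exists (fun k => if k is k'.+1 then f k' else n).
  by case => // k; rewrite mkseqSl; exact: fx.
exists (f 0%N) => //; rewrite (FP _).2; exists (f \o S) => k.
by move: (fx k.+1); rewrite mkseqSl.
Qed.

(** One branch can code countably many: entry [j] of the [n]-th branch is stored at position
    [pickle (n, j)]. *)
Lemma suslin_bigcap (E : nat -> set T) :
  (forall n, suslin (E n)) -> suslin (\bigcap_n E n).
Proof.
move=> Esus.
have /choice[F FP] : forall n, exists F : seq nat -> set T,
    (forall s, closed (F s)) /\ E n = [set x | exists f, forall k, F (mkseq f k) x].
  by move=> n; have [F ? ?] := Esus n; exists F.
pose c (n j : nat) : nat := pickle (n, j).
pose sub s n k := mkseq (fun j => nth 0%N s (c n j)) k.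
(* The set at prefix [s] imposes every condition on a coded branch that the entries of [s] already
   determine. *)
exists (fun s => \bigcap_(p in [set p : nat * nat |
    forall j, (j < p.2)%N -> (c p.1 j < size s)%N]) F p.1 (sub s p.1 p.2)).
  by move=> s; apply: closed_bigI => p _; exact: (FP p.1).1.
have subE f n k l : (forall j, (j < k)%N -> (c n j < l)%N) ->
    sub (mkseq f l) n k = mkseq (f \o c n) k.
  move=> h; apply: (@eq_from_nth _ 0%N); rewrite ?size_mkseq// => j jk.
  by rewrite !nth_mkseq// h.
apply/seteqP; split=> [x Ex|x [f fx] n _].
  have /choice[f fP] : forall n, exists f, forall k, F n (mkseq f k) x.
    by move=> n; have := Ex n I; rewrite (FP n).2.
  exists (fun p => if unpickle p is Some nj then f (nj : nat * nat).1 nj.2 else 0%N) => l [n k] /= h.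
  rewrite subE//; last by move=> j /h; rewrite size_mkseq.
  by rewrite (@eq_mkseq _ _ (f n)) => [|j]; [exact: fP|rewrite /c /= pickleK].
rewrite (FP n).2; exists (f \o c n) => k.
(* A prefix of length [l] contains all coded positions of the first [k] entries of branch [n]. *)
pose l := (\max_(j < k) c n j).+1.
have lP j : (j < k)%N -> (c n j < l)%N.
  by move=> jk; rewrite ltnS; exact: (leq_bigmax (Ordinal jk)).
rewrite -(subE _ _ _ _ lP); apply: (fx l (n, k)) => j jk.
by rewrite size_mkseq; exact: lP.
Qed.

Lemma suslin_sigma_algebra :
  (forall U : set T, open U -> suslin U) -> <<s @open T >> `<=` suslin.
Proof.
move=> osus.
suff h : <<s @open T >> `<=` [set E | suslin E /\ suslin (~` E)] by move=> E /h[].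
apply: smallest_sub => [|U oU]; last first.
  by split; [exact: osus|apply: suslin_closed; exact: open_closedC].
split=> [|E [E1 E2]|E Es].
- by rewrite /= setC0; split; apply: suslin_closed; [exact: closed0|exact: closedT].
- by rewrite /= setTD setCK.
- split; first by apply: suslin_bigcup => n; exact: (Es n).1.
  by rewrite setC_bigcup; apply: suslin_bigcap => n; exact: (Es n).2.
Qed.

(* Bounding the indices by [b] makes the unions finite, so that these sets are
   closed, and makes Koenig's lemma applicable to their intersection over [k]. *)
Fixpoint scheme_ext F (b : nat -> nat) k s : set T :=
  F s `&` (if k is k'.+1 then
    \bigcup_(v in `I_(b (size s)).+1) scheme_ext F b k' (rcons s v) else setT).

Lemma closed_scheme_ext F b k s :
  (forall s, closed (F s)) -> closed (scheme_ext F b k s).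
Proof.
move=> clF; elim: k s => [|k IH] s /=; apply: closedI => //.
by apply: closed_bigcup => // v _; exact: IH.
Qed.

Lemma scheme_extS F b k s : scheme_ext F b k.+1 s `<=` scheme_ext F b k s.
Proof.
elim: k s => [|k IH] s x /=; first by case.
by move=> [Fx [v vb vx]]; split => //; exists v => //; exact: IH.
Qed.

Lemma mem_scheme_ext F b f x k j : (forall i, (i < k + j)%N -> (f i <= b i)%N) ->
  (forall n, F (mkseq f n) x) -> scheme_ext F b k (mkseq f j) x.
Proof.
move=> + Fx; elim: k j => [|k IH] j fb /=; split=> //.
exists (f j); first by rewrite /= size_mkseq ltnS fb// addSn ltnS leq_addl.
by rewrite -mkseqS; apply: IH => i; rewrite addnS -addSn; exact: fb.
Qed.

(** Koenig's lemma: a node extendable to every depth has a child with the same property, and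
    following such children yields a branch. *)
Lemma bigcap_scheme_ext F b :
  \bigcap_k scheme_ext F b k [::] `<=` [set x | exists f, forall n, F (mkseq f n) x].
Proof.
move=> x h.
have [|s sx|f fx] := @seq_dependent_choice (fun s => forall k, scheme_ext F b k s x).
- by move=> k; exact: h.
- apply: contrapT => /forallNP nx.
  have /choice[k kP] : forall v, exists k, ~ scheme_ext F b k (rcons s v) x.
    by move=> v; apply/existsNP; exact: nx.
  have mono v i j : (i <= j)%N -> scheme_ext F b j (rcons s v) x ->
      scheme_ext F b i (rcons s v) x.
    by move=> /subnK <-; elim: (j - i)%N => // l IH /scheme_extS /IH.
  (* If each of the finitely many children failed at some depth, all would fail at the maximum of
     these depths. *)
  have /= [_ [v vb vx]] := sx (\max_(v < (b (size s)).+1) k v).+1.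
  by apply: (kP v); apply: mono vx; exact: (leq_bigmax (Ordinal vb)).
- by exists f => n; have := fx n 0%N => -[].
Qed.

End suslin.

Section capacity.
Context (R : realType) (m : nat) (N : 'rV[R]_m -> R) (N_norm : is_norm N).
Context (P : probability (borelV R m) R) (r : R).

Lemma open_borelV (U : set 'rV[R]_m) : open U -> measurable (U : set (borelV R m)).
Proof. by move=> oU; exact: sub_gen_smallest. Qed.

Lemma closed_borelV (C : set 'rV[R]_m) : closed C -> measurable (C : set (borelV R m)).
Proof.
by move=> clC; rewrite -[C]setCK; apply: measurableC; apply: open_borelV; exact: closed_openC.
Qed.

Lemma borelV_suslin (E : set (borelV R m)) : measurable E -> suslin (E : set 'rV[R]_m).
Proof.
apply: suslin_sigma_algebra => U oU.
(* An open set is a countable union of closed sets: [C n] holds the points whose open ball of radius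
   [1/(n+1)] lies in [U]. *)
pose C n := [set x : 'rV[R]_m | forall y, N (y - x) < n.+1%:R^-1 -> U y].
have -> : U = \bigcup_n C n.
  apply/seteqP; split=> [x Ux|x [n _]]; last first.
    by apply; rewrite subrr is_norm0// invr_gt0.
  have [e e0 eU] := is_norm_nbhs N_norm (open_nbhs_nbhs (conj oU Ux)).
  have [n] := ltr_add_invr e0; rewrite add0r => ne.
  by exists n => // y yx; apply: eU; exact: lt_trans ne.
apply: suslin_bigcup => n; apply: suslin_closed => x clx y yx.
have n0 : 0 < n.+1%:R^-1 - N (y - x) by rewrite subr_gt0.
have [z [Cz zx]] := clx _ (nbhs_is_norm N_norm x n0).
apply: Cz; apply: (le_lt_trans (is_norm_split N_norm x _ _)).
by rewrite (is_normB N_norm x) -ltrBrDl.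
Qed.

(** * Outer measure and Choquet's theorem *)

Definition outer_le (a : \bar R) (S : set 'rV[R]_m) :=
  exists B : set (borelV R m), [/\ measurable B, S `<=` B & (P B <= a)%E].

(** Outer measure is continuous along increasing sets: the tail intersections of the measurable
    covers increase, still cover, and have measure at most [a]. *)
Lemma outer_le_bigcup a (S : nat -> set 'rV[R]_m) :
  (forall n, S n `<=` S n.+1) -> (forall n, outer_le a (S n)) ->
  outer_le a (\bigcup_n S n).
Proof.
move=> Sm /choice[B BP].
have SS i j : (i <= j)%N -> S i `<=` S j.
  by move=> /subnK <-; elim: (j - i)%N => // k IH x /IH /Sm.
pose B' n := \bigcap_(k in [set k | (n <= k)%N]) B k.
have mB' n : measurable (B' n) by apply: bigcap_measurable => [|k _]; [exists n => /=|case: (BP k)].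
exists (\bigcup_n B' n); split.
- exact: bigcup_measurable.
- move=> x [n _ Sx]; exists n => // k /= nk; case: (BP k) => _ + _; apply.
  exact: SS Sx.
- have cB := @nondecreasing_cvg_mu _ _ _ P B' mB' (bigcup_measurable (fun n _ => mB' n)).
  rewrite -(cvg_lim _ (cB _))//; last first.
    apply/nondecreasing_seqP => n; apply/subsetPset => x Bx k /= nk.
    by apply: Bx => /=; exact: ltnW.
  apply: lime_le.
    apply/cvg_ex; eexists; apply: cB; apply/nondecreasing_seqP => n.
    by apply/subsetPset => x Bx k /= nk; apply: Bx => /=; exact: ltnW.
  apply: nearW => n /=; have [mB _] := BP n; apply: le_trans.
  by apply: le_measure; rewrite ?inE// => x; apply => /=.
Qed.

(* Choquet's capacitability theorem for the capacity [E |-> P^*(thicken r E)]. *)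
Lemma suslin_capacitable (a : \bar R) (E : set 'rV[R]_m) : suslin E ->
  ~ outer_le a (thicken N r E) ->
  exists K, [/\ closed K, K `<=` E & (a <= P (thicken N r K))%E].
Proof.
move=> [F clF ->] aE.
(* Points having a branch whose first entries are bounded by those of [p]. *)
pose D p := [set x : 'rV[R]_m | exists f : nat -> nat,
  (forall i, (i < size p)%N -> (f i <= nth 0%N p i)%N) /\ forall n, F (mkseq f n) x].
(* The bounds are chosen one by one: [D p] is the increasing union of the [D (rcons p v)], so some
   [v] keeps the outer measure of the thickening above [a]. *)
have [|p Dp|b bP] := @seq_dependent_choice (fun p => ~ outer_le a (thicken N r (D p))).
- apply: contra_not aE => -[B [mB DB PB]]; exists B; split=> //.
  apply: subset_trans DB; apply: thickenS => x [f fx].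
  by exists f; split.
- apply: contrapT => /forallNP h; apply: Dp.
  have -> : thicken N r (D p) = \bigcup_v thicken N r (D (rcons p v)).
    apply/seteqP; split=> [z [x [f [fp fx]] xz]|z [v _ [x [f [fp fx]] xz]]].
      exists (f (size p)) => //; exists x => //; exists f; split=> // i.
      rewrite size_rcons ltnS leq_eqVlt nth_rcons => /predU1P[->|ip].
        by rewrite ltnn eqxx.
      by rewrite ip fp.
    exists x => //; exists f; split=> // i ip.
    by have := fp i; rewrite size_rcons nth_rcons ip; apply; exact: ltnW.
  apply: outer_le_bigcup => v; last by apply: contrapT; exact: h.
  apply: thickenS => x [f [fp fx]]; exists f; split=> // i ip.
  have := fp i; rewrite size_rcons in ip *; rewrite size_rcons !nth_rcons => /(_ ip).
  by case: ifP => // _; case: ifP => // _ /leqW.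
(* [L k] is closed and contains [D] at the first [k] bounds, so its thickening has measure above
   [a]; by Koenig's lemma the [L k] decrease to a closed subset of the Suslin set. *)
pose L k := scheme_ext F b k [::].
have clL k : closed (L k) by exact: closed_scheme_ext.
have mL k : measurable (thicken N r (L k) : set (borelV R m)).
  by apply: closed_borelV; exact: closed_thicken.
have clK : closed (\bigcap_k L k) by exact: closed_bigI.
have Ld k : L k.+1 `<=` L k by exact: scheme_extS.
have cL : P (thicken N r (L k)) @[k --> \oo] --> P (\bigcap_k thicken N r (L k)).
  apply: nonincreasing_cvg_mu => //.
  - by rewrite ltey_eq fin_num_measure.
  - exact: bigcap_measurable.
  - by apply/nonincreasing_seqP => k; apply/subsetPset; exact: thickenS.
exists (\bigcap_k L k); split => //; first exact: bigcap_scheme_ext.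
have -> : thicken N r (\bigcap_k L k) = \bigcap_k thicken N r (L k).
  apply/seteqP; split; last exact: bigcap_thicken.
  by move=> z [x Lx xz] k _; exists x => //; exact: Lx.
rewrite -(cvg_lim _ cL)//; apply: lime_ge; first by apply/cvg_ex; eexists; exact: cL.
apply: nearW => k; rewrite leNgt; apply/negP => /ltW PL.
apply: (bP k); exists (thicken N r (L k)); split => //.
apply: thickenS => x [f [fb fx]]; apply: (@mem_scheme_ext _ F b f x k 0) => // i.
by rewrite addn0 => ik; have := fb i; rewrite size_mkseq nth_mkseq//; exact.
Qed.

Lemma borelV_capacitable (a : \bar R) (E B : set (borelV R m)) :
  measurable E -> measurable B -> B `<=` thicken N r E -> (a < P B)%E ->
  exists K : set 'rV[R]_m, [/\ closed K, K `<=` E & (a <= P (thicken N r K))%E].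
Proof.
move=> mE mB BE aB; apply: suslin_capacitable; first exact: borelV_suslin.
move=> [B' [mB' EB']]; rewrite leNgt => /negP; apply; apply: (lt_le_trans aB).
by apply: le_measure; rewrite ?inE//; exact: subset_trans BE EB'.
Qed.

End capacity.

(** * Distributions in the ambiguity set *)

Lemma probability_setI_full d (T : measurableType d) (R : realType)
    (P : probability T R) (A B : set T) :
  measurable A -> measurable B -> P B = 1%E -> P (A `&` B) = P A.
Proof.
move=> mA mB PB; rewrite -[in RHS](setUIDK A B) measureU//; last first.
- by rewrite setDE setIACA setICr setI0.
- exact: measurableD.
- exact: measurableI.
rewrite [X in (_ + X)%E](_ : _ = 0%E) ?adde0//.
apply/eqP; rewrite eq_le measure_ge0 andbT.
apply: (@le_trans _ _ (P (~` B))); last by rewrite probability_setC// PB subee.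
by apply: le_measure; rewrite ?inE; [exact: measurableD|exact: measurableC|exact: subIsetr].
Qed.

(** * Upper bounds from couplings *)

Section ambiguity_upper.
Context (R : realType) (m : nat) (N : 'rV[R]_m -> R) (N_norm : is_norm N).
Context (P Pz : probability (borelV R m) R) (theta : R).
Hypothesis W_le : (wasserstein_infty N P Pz <= theta%:E)%E.

(* The infimum defining [wasserstein_infty] is not known to be attained, hence
   the margin [e]. *)
Lemma wasserstein_le_thicken_gt (K : set 'rV[R]_m) (e : R) : closed K -> 0 < e ->
  (P K <= Pz (thicken N (theta + e) K))%E.
Proof.
move=> clK e0.
have : (wasserstein_infty N P Pz < (theta + e)%:E)%E.
  by apply: (le_lt_trans W_le); rewrite lte_fin ltrDl.
move=> /ereal_inf_lt[_ [Q [Q1 Q2] <-]].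
(* The essential supremum is an infimum too: some bound [y] below [theta + e] holds off a [Q]-null
   set [Z]. *)
move=> /ereal_inf_lt[y /= [Z [mZ QZ ZP]] ye].
have mK := closed_borelV clK.
have mK' := closed_borelV (closed_thicken N_norm (r := theta + e) clK).
rewrite -Q1// -Q2//.
have mKT : measurable (K `*` setT : set (borelV R m * borelV R m)) by exact: measurableX.
have mTK : measurable (setT `*` thicken N (theta + e) K : set (borelV R m * borelV R m)).
  exact: measurableX.
apply: (@le_trans _ _ (Q ((setT `*` thicken N (theta + e) K) `|` Z))).
  apply: le_measure; rewrite ?inE//; first exact: measurableU.
  move=> [x z] [/= Kx _]; have [xz|xz] := leP (N (x - z)) (theta + e).
    by left; split => //=; exists x.
  right; apply: ZP => /= xy; move: (le_lt_trans xy ye).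
  by rewrite lte_fin ltNge (ltW xz).
apply: (le_trans (measureU2 _ mTK mZ)).
by rewrite [X in (_ + X <= _)%E]QZ adde0.
Qed.

Lemma wasserstein_le_thicken (K : set 'rV[R]_m) : closed K ->
  (P K <= Pz (thicken N theta K))%E.
Proof.
move=> clK.
pose S n : set (borelV R m) := thicken N (theta + n.+1%:R^-1) K.
have mS n : measurable (S n) by apply: closed_borelV; exact: closed_thicken.
have cS : Pz (S k) @[k --> \oo] --> Pz (\bigcap_k S k).
  apply: nonincreasing_cvg_mu => //.
  - by rewrite ltey_eq fin_num_measure.
  - exact: bigcap_measurable.
  - apply/nonincreasing_seqP => k; apply/subsetPset => z [x Kx xz].
    exists x => //; apply: (le_trans xz).
    by rewrite lerD2l lef_pV2 ?posrE// ler_nat.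
apply: (@le_trans _ _ (Pz (\bigcap_k S k))).
  rewrite -(cvg_lim _ cS)//; apply: lime_ge; first by apply/cvg_ex; eexists; exact: cS.
  by apply: nearW => k; apply: wasserstein_le_thicken_gt.
apply: le_measure; rewrite ?inE.
- exact: bigcap_measurable.
- by apply: closed_borelV; exact: closed_thicken.
- by move=> z Sz; apply: bigcap_thicken_radius => // n; exact: Sz.
Qed.

(** Otherwise a closed subset of [A] with [P]-measure above [Pz B] would contradict the bound for
    closed sets. *)
Lemma wasserstein_le_borel (Xi A B : set (borelV R m)) :
  measurable Xi -> Pz Xi = 1%E -> measurable A -> measurable B ->
  thicken N theta A `&` Xi `<=` B -> (P A <= Pz B)%E.
Proof.
move=> mXi PXi mA mB AB; rewrite leNgt; apply/negP => BA.
have [a /andP[Ba aA]] : exists a, (Pz B < a < P A)%E.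
  have [b bE] : exists b, Pz B = b%:E by exists (fine (Pz B)); rewrite fineK ?fin_num_measure.
  have [p pE] : exists p, P A = p%:E by exists (fine (P A)); rewrite fineK ?fin_num_measure.
  by exists ((b + p) / 2)%:E; rewrite bE pE !lte_fin in BA *; rewrite !midf_lt.
(* With radius 0 thickening is the identity, and capacitability becomes inner regularity by closed
   sets. *)
have := @borelV_capacitable _ _ _ N_norm P 0 a A A mA mA.
rewrite thicken0// => /(_ (@subset_refl _ _) aA)[K [clK KA]].
rewrite thicken0// => aK; have := lt_le_trans Ba (le_trans aK (wasserstein_le_thicken clK)).
apply/negP; rewrite -leNgt.
have mK : measurable (thicken N theta K : set (borelV R m)).
  by apply: closed_borelV; exact: closed_thicken.
rewrite -(probability_setI_full mK mXi PXi).
apply: le_measure; rewrite ?inE//; first exact: measurableI.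
by apply: subset_trans AB; apply: setSI; exact: thickenS.
Qed.

End ambiguity_upper.

(** * Measurable selection of near points *)

Section selection.
Context (R : realType) (m : nat) (N : 'rV[R]_m -> R) (N_norm : is_norm N).
Context (r : R) (K : set 'rV[R]_m) (clK : closed K).

(** An enumeration of the closed balls with rational centre and radius; an index coding no ball
    gives [setT], which restricts nothing. *)
Let C n : set 'rV[R]_m :=
  if unpickle n is Some p
  then [set x | N (x - map_mx ratr (p : 'rV[rat]_m * rat).1) <= ratr p.2]
  else setT.

Let clC n : closed (C n).
Proof.
rewrite /C; case: unpickle => [[q s]|]; last exact: closedT.
exact: is_norm_ball_closed.
Qed.

Let C_separates x y : (forall n, C n x -> C n y) -> x = y.
Proof.
move=> h; apply: contrapT => /eqP xy.
have N0 : 0 < N (x - y).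
  rewrite lt_def is_norm_ge0// andbT; apply: contra_neq xy => /eqP.
  by move=> /eqP; have [Nd _ _] := N_norm => /Nd/eqP; rewrite subr_eq0 => /eqP.
have h0 : 0 < N (x - y) / 2 by exact: divr_gt0.
have [q xq] := rat_dense N_norm x h0.
have [s] := rat_in_itvoo xq; rewrite in_itv/= => /andP[qs sh].
have := h (pickle (q, s)); rewrite /C pickleK/= => /(_ (ltW qs)) yq.
have := is_norm_split N_norm (map_mx ratr q) x y.
by rewrite (is_normB N_norm (map_mx ratr q)); lra.
Qed.

(* The [C n] separate points, so restricting to [C n] whenever this is possible
   leaves exactly one candidate in the limit. *)
Let G := fix G n z : set 'rV[R]_m := match n with
  | 0 => K `&` [set x | N (x - z) <= r]
  | n'.+1 => [set x | G n' z x /\ (G n' z `&` C n' !=set0 -> C n' x)]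
  end.

Let clG n z : closed (G n z).
Proof.
elim: n => [|n IH] /=; first by apply: closedI => //; exact: is_norm_ball_closed.
have [h|h] := pselect (G n z `&` C n !=set0).
  rewrite (_ : [set x | _] = G n z `&` C n); first exact: closedI.
  by apply/seteqP; split => x [Gx Cx]; split => //; exact: Cx.
by rewrite (_ : [set x | _] = G n z)//; apply/seteqP; split => x // [].
Qed.

Let Gd n z : G n.+1 z `<=` G n z.
Proof. by move=> x []. Qed.

Let G0 n z : thicken N r K z -> G n z !=set0.
Proof.
move=> [x Kx xz]; elim: n => [|n [y Gy]]; first by exists x.
by have [[w [Gw Cw]]|h] := pselect (G n z `&` C n !=set0); [exists w|exists y].
Qed.

Let G_ball n z : G n z `<=` [set x | N (x - z) <= r].
Proof. by elim: n => [|n IH] x []// /IH. Qed.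

(** The induction needs all closed [D] at once: hitting [D] at stage [n.+1] is decided by whether
    stage [n] hits [C n], their intersection with [D], or only [D]. *)
Let measurable_hit n (D : set 'rV[R]_m) : closed D ->
  measurable ([set z | G n z `&` D !=set0] : set (borelV R m)).
Proof.
elim: n D => [|n IH] D clD.
  rewrite (_ : [set z | _] = thicken N r (K `&` D)).
    by apply: closed_borelV; apply: closed_thicken => //; exact: closedI.
  by apply/seteqP; split => [z [x [[Kx xz] Dx]]|z [x [Kx Dx] xz]]; exists x.
pose H D := [set z | G n z `&` D !=set0] : set (borelV R m).
rewrite (_ : [set z | _] = (H (C n) `&` H (C n `&` D)) `|` (H D `\` H (C n))).
  apply: measurableU; [apply: measurableI|apply: measurableD]; apply: IH => //.
  exact: closedI.
apply/seteqP; split=> [z [x [[Gx Cx] Dx]]|z].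
  have [h|h] := pselect (H (C n) z); last by right; split => //; exists x.
  by left; split => //; exists x; split => //; split => //; exact: Cx.
move=> [[_ [x [Gx [Cx Dx]]]]|[[x [Gx Dx]] h]]; first by exists x.
by exists x; split => //; split.
Qed.

Lemma thicken_selection : exists T : 'rV[R]_m -> 'rV[R]_m,
  (forall D, closed D ->
     measurable ([set z | thicken N r K z /\ D (T z)] : set (borelV R m))) /\
  (forall z, thicken N r K z -> K (T z) /\ N (T z - z) <= r).
Proof.
have /choice[T TP] : forall z, exists x, thicken N r K z -> forall n, G n z x.
  move=> z; have [Kz|] := pselect (thicken N r K z); last by exists z.
  have [||||x xP] := @nested_compact _ _ (G^~ z) (@is_norm_ball_compact _ _ _ N_norm z r).
  - by move=> n; exact: clG.
  - by move=> n; exact: G_ball.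
  - by move=> n; exact: Gd.
  - by move=> n; exact: G0.
  - by exists x.
exists T; split => [D clD|z Kz]; last by have [] := TP z Kz 0%N.
(* By compactness, [T z] lies in [D] exactly when every stage [G n z] meets [D]. *)
rewrite (_ : [set z | _] = thicken N r K `&` \bigcap_n [set z | G n z `&` D !=set0]).
  apply: measurableI; first by apply: closed_borelV; exact: closed_thicken.
  by apply: bigcap_measurable => [|n _]; [exists 0%N|exact: measurable_hit].
apply/seteqP; split=> [z [Kz Dz]|z [Kz h]].
  by split => // n _; exists (T z); split => //; exact: TP.
split=> //.
have [||||x xP] := @nested_compact _ _ (fun n => G n z `&` D)
    (@is_norm_ball_compact _ _ _ N_norm z r).
- by move=> n; apply: closedI.
- by move=> n x [/G_ball].
- by move=> n x [/Gd].
- by move=> n; exact: h.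
(* If [T z] lies in [C n] then stage [n] meets [C n], so [x], which survives stage [n.+1], lies in
   [C n] too. *)
- suff -> : T z = x by case: (xP 0%N).
  apply: C_separates => n Cx; have [[_ h1] _] := xP n.+1; apply: h1.
  by exists (T z); split => //; exact: TP.
Qed.

End selection.

(** * Almost optimal transport maps *)

Section transport.
Context (R : realType) (m : nat) (N : 'rV[R]_m -> R) (N_norm : is_norm N).
Context (theta : R) (theta_ge0 : 0 <= theta).
Context (Xi : set (borelV R m)) (mXi : measurable Xi).
Context (Pz : probability (borelV R m) R) (Pz_Xi : Pz Xi = 1%E).

Lemma measurable_fun_closed (T : borelV R m -> borelV R m) :
  (forall D : set 'rV[R]_m, closed D -> measurable (T @^-1` D)) ->
  measurable_fun setT T.
Proof.
move=> mT; apply: (@measurability _ _ (borelV R m) (borelV R m) setT T (@open 'rV[R]_m)) => //.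
move=> _ [U oU <-]; rewrite setTI -[U]setCK -preimage_setC.
by apply: measurableC; apply: mT; exact: open_closedC.
Qed.

(* The product of the two Borel sigma-algebras contains this open set because
   it is a countable union of rectangles. *)
Lemma measurable_norm_gt (a : R) :
  measurable [set p : borelV R m * borelV R m | a < N (p.1 - p.2)].
Proof.
pose c n : 'rV[rat]_m * rat := odflt (0, 0) (unpickle n).
pose q n := map_mx ratr (c n).1 : 'rV[R]_m.
pose s n := ratr (c n).2 : R.
(* If [a < N (x - z)], some rational [q] and [s] have [z] within [s] of [q] and [x] farther than
   [a + s] from [q]; the converse is the triangle inequality. *)
rewrite (_ : [set p | _] = \bigcup_n
    ((~` [set x | N (x - q n) <= a + s n]) `*` (~` [set z | s n <= N (z - q n)]))).
  apply: bigcup_measurable => n _; apply: measurableX.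
    by apply: measurableC; apply: closed_borelV; exact: is_norm_ball_closed.
  rewrite (_ : ~` _ = [set z | N (z - q n) < s n]); last first.
    by apply/seteqP; split => z /=; rewrite ltNge => /negP.
  apply: open_borelV; rewrite openE => z /= zs.
  have zs0 : 0 < s n - N (z - q n) by rewrite subr_gt0.
  apply: filterS (nbhs_is_norm N_norm z zs0) => y /= yz.
  by apply: (le_lt_trans (is_norm_split N_norm z _ _)); rewrite -ltrBrDr.
apply/seteqP; split => [[x z] /= xz|[x z] [n _ [/= /negP + /negP]]]; last first.
  rewrite -!ltNge => h1 h2; have := is_norm_split N_norm z x (q n).
  by lra.
have h0 : 0 < (N (x - z) - a) / 2 by rewrite divr_gt0// subr_gt0.
have [u zu] := rat_dense N_norm z h0.
have [t] := rat_in_itvoo zu; rewrite in_itv/= => /andP[ut th].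
exists (pickle (u, t)) => //; rewrite /q /s /c pickleK/=.
split; apply/negP; rewrite -ltNge//.
have := is_norm_split N_norm (map_mx ratr u) x z.
by rewrite (is_normB N_norm (map_mx ratr u)); lra.
Qed.

(** The law of [(T z, z)] under [Pz] is a coupling whose distance never exceeds [theta]. *)
Lemma law_in_ambiguity_set (T : borelV R m -> borelV R m) :
  measurable_fun setT T -> (forall z, N (T z - z) <= theta) ->
  (forall z, Xi z -> Xi (T z)) ->
  exists2 P, ambiguity_set N Xi Pz theta P & P = pushforward Pz T :> (set _ -> _).
Proof.
move=> mT TN TXi.
pose T' : {mfun borelV R m >-> borelV R m} := mfun_Sub (mem_set mT).
pose TI : borelV R m -> borelV R m * borelV R m := fun z => (T z, z).
have mTI : measurable_fun setT TI by apply: measurable_fun_pair => //; exact: measurable_id.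
pose TI' : {mfun borelV R m >-> (borelV R m * borelV R m)%type} := mfun_Sub (mem_set mTI).
exists (distribution Pz T') => //; split.
  apply/eqP; rewrite eq_le probability_le1//= -{1}Pz_Xi.
  rewrite /distribution/= /pushforward; apply: le_measure; rewrite ?inE//.
  by have := mT measurableT _ mXi; rewrite setTI.
apply: (@le_trans _ _ (ess_sup (distribution Pz TI')
    (fun p => (N ((p.1 : 'rV[R]_m) - (p.2 : 'rV[R]_m)))%:E))).
  apply: ereal_inf_lbound; exists (distribution Pz TI') => //; split => A mA /=.
    by rewrite /distribution/= /pushforward; congr (Pz _); apply/seteqP; split => // z [].
  by rewrite /distribution/= /pushforward; congr (Pz _); apply/seteqP; split => // z [].
apply: ereal_inf_lbound => /=.
exists [set p : borelV R m * borelV R m | theta < N (p.1 - p.2)]; split.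
- exact: measurable_norm_gt.
- rewrite /distribution/= /pushforward (_ : _ @^-1` _ = set0) ?measure0//.
  by apply/seteqP; split => // z /=; rewrite ltNge TN.
- by move=> p /= /negP; rewrite lee_fin -ltNge.
Qed.

Context (f fb : borelV R m -> R).
Context (mf : measurable_fun Xi f) (mfb : measurable_fun Xi fb).
Context (f_le : forall z x, Xi z -> Xi x -> N (x - z) <= theta -> f x <= fb z).
Context (f_att : forall z, Xi z -> exists x, [/\ Xi x, N (x - z) <= theta & f x = fb z]).

Lemma almost_worst_transport (d : R) : 0 < d ->
  exists T : borelV R m -> borelV R m, [/\ measurable_fun setT T,
    forall z, N (T z - z) <= theta, forall z, Xi z -> Xi (T z) &
    exists Z, [/\ measurable Z, Pz Z = 0%E &
      forall z, Xi z -> ~ Z z -> fb z - d <= f (T z)]].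
Proof.
move=> d0.
(* The levels are the integer multiples of [d]; a code of no integer gives level 0. *)
pose lev n : R := (odflt (0 : int) (unpickle n))%:~R * d.
pose A n : set (borelV R m) := Xi `&` f @^-1` `[lev n, +oo[.
pose B n : set (borelV R m) := Xi `&` fb @^-1` `[lev n, +oo[.
pose B' n : set (borelV R m) := Xi `&` fb @^-1` `]-oo, (lev n + d)[.
have mA n : measurable (A n) by apply: mf => //; exact: measurable_itv.
have mB n : measurable (B n) by apply: mfb => //; exact: measurable_itv.
have mB' n : measurable (B' n) by apply: mfb => //; exact: measurable_itv.
have BA n : B n `<=` thicken N theta (A n).
  move=> z [Xz]; rewrite /= in_itv/= andbT => Bz.
  have [x [Xx xz fx]] := f_att Xz; exists x => //; split => //=.
  by rewrite in_itv/= andbT fx.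
have AB n : thicken N theta (A n) `&` Xi `<=` B n.
  move=> z [[x [Xx]]]; rewrite /= in_itv/= andbT => Ax xz Xz; split=> //=.
  by rewrite in_itv/= andbT (le_trans Ax)// f_le.
(* For [p = (n, k)], the thickening of [K p] has [Pz]-measure at least that of [B n] less
   [1/(k+1)]. *)
have /choice[K KP] : forall p : nat * nat, exists K : set 'rV[R]_m,
    [/\ closed K, K `<=` A p.1 &
      (Pz (B p.1) - (p.2.+1%:R^-1)%:E <= Pz (thicken N theta K))%E].
  move=> [n k] /=; apply: (borelV_capacitable N_norm (mA n) (mB n) (BA n)).
  by rewrite -[X in (_ < X)%E]adde0 lteD2lE ?fin_num_measure// lte_fin oppr_lt0 invr_gt0.
have mK p : measurable (thicken N theta (K p) : set (borelV R m)).
  by apply: closed_borelV; apply: closed_thicken => //; case: (KP p).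
have /choice[S SP] : forall p : nat * nat, exists S : 'rV[R]_m -> 'rV[R]_m,
    (forall D, closed D ->
      measurable ([set z | thicken N theta (K p) z /\ D (S z)] : set (borelV R m))) /\
    (forall z, thicken N theta (K p) z -> K p (S z) /\ N (S z - z) <= theta).
  by move=> p; apply: thicken_selection => //; case: (KP p).
pose c q : nat * nat := odflt (0%N, 0%N) (unpickle q).
(* Where [fb] is below [lev + d], moving into [A] at level [lev] loses less than [d]. *)
pose D q := thicken N theta (K (c q)) `&` B' (c q).1.
have mD q : measurable (D q : set (borelV R m)) by exact: measurableI.
(* The [D q] overlap; the first one containing [z] decides where [z] moves, and points in none stay
   put. *)
pose E := seqDU (D : nat -> set (borelV R m)).
have mE q : measurable (E q).
  by apply: measurableD => //; exact: bigsetU_measurable.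
have ED q : E q `<=` D q by exact: subset_seqDU.
have E1 z q q' : E q z -> E q' z -> q = q'.
  by move=> Eq Eq'; apply: (@trivIset_seqDU _ D q q' I I); exists z.
have /choice[T TP] : forall z : borelV R m, exists y : borelV R m,
    (forall q, E q z -> y = S (c q) z) /\ ((forall q, ~ E q z) -> y = z).
  move=> z; have [[q Eq]|/forallNP nE] := pselect (exists q, E q z).
    exists (S (c q) z); split => [q' /(E1 _ _ _ Eq) <-//|/(_ q)//].
  by exists z; split => // q /nE.
have Tcase z : (exists2 q, D q z & T z = S (c q) z) \/ T z = z.
  have [[q Eq]|/forallNP nE] := pselect (exists q, E q z).
    by left; exists q; [exact: ED|exact: (TP z).1].
  by right; exact: (TP z).2.
exists T; split.
- apply: measurable_fun_closed => C clC.
  rewrite (_ : _ @^-1` _ = (\bigcup_q (E q `&` [set z | thicken N theta (K (c q)) z /\ C (S (c q) z)]))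
      `|` (~` (\bigcup_q E q) `&` C)).
    apply: measurableU.
      by apply: bigcup_measurable => q _; apply: measurableI => //; exact: (SP _).1.
    apply: measurableI; last exact: closed_borelV.
    by apply: measurableC; exact: bigcup_measurable.
  apply/seteqP; split=> [z /= Cz|z [[q _ [Eq [_ Cz]]]|[nE Cz]]] /=.
  + have [[q Eq]|/forallNP nE] := pselect (exists q, E q z).
      left; exists q => //; split=> //; split; first by case: (ED _ _ Eq).
      by rewrite -((TP z).1 q).
    by right; rewrite ((TP z).2 nE) in Cz; split => // -[q _ /nE].
  + by rewrite ((TP z).1 q).
  + by rewrite ((TP z).2)// => q Eq; apply: nE; exists q.
- move=> z; have [[q [Kz _] ->]|->] := Tcase z; first by case: ((SP (c q)).2 z Kz).
  by rewrite subrr is_norm0.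
- move=> z Xz; have [[q [Kz _] ->]|->//] := Tcase z.
  have [Kq _] := (SP (c q)).2 z Kz.
  by have [_ /(_ _ Kq)[]] := KP (c q).
have [Z [mZ Z0 ZP]] : Pz.-negligible (\bigcup_n (B n `\` \bigcup_k thicken N theta (K (n, k)))).
  apply: negligible_bigcup => n.
  have mUK : measurable (\bigcup_k thicken N theta (K (n, k)) : set (borelV R m)).
    exact: bigcup_measurable.
  exists (B n `\` \bigcup_k thicken N theta (K (n, k))); split => //.
    exact: measurableD.
  apply/eqP; rewrite eq_le measure_ge0 andbT.
  apply/lee_addgt0Pr => e e0; rewrite add0e.
  have [k] := ltr_add_invr e0; rewrite add0r => /ltW ke.
  have [clK KA PK] := KP (n, k).
  have mKB : measurable (B n `&` thicken N theta (K (n, k)) : set (borelV R m)).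
    exact: measurableI.
  apply: (@le_trans _ _ (Pz (B n `\` thicken N theta (K (n, k))))).
    apply: le_measure; rewrite ?inE; [exact: measurableD|exact: measurableD|].
    by apply: setDS => z Kz; exists k.
  rewrite measureD//; last by rewrite ltey_eq fin_num_measure.
  (* Inside [Xi], the thickening of a subset of [A n] lies in [B n], so intersecting with [B n]
     loses only a null set. *)
  rewrite [X in (_ - X <= _)%E](_ : _ = Pz (thicken N theta (K (n, k)))); last first.
    rewrite -[RHS](probability_setI_full (mK (n, k)) mXi Pz_Xi); congr (Pz _).
    apply/seteqP; split=> [z [[Xz _]]//|z [Kz Xz]]; split => //.
    by apply: AB; split=> //; exact: thickenS Kz.
  rewrite leeBlDr ?fin_num_measure//.
  have := PK; rewrite leeBlDr// => /le_trans; apply.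
  by rewrite addeC leeD2r// lee_fin.
exists Z; split => // z Xz nZ.
have [q Dq] : exists q, D q z.
  (* This level satisfies [j d <= fb z < (j + 1) d]. *)
  pose j := Num.floor (fb z / d).
  have levE : lev (pickle j) = j%:~R * d by rewrite /lev pickleK.
  have Bz : B (pickle j) z.
    split=> //=; rewrite in_itv/= andbT levE -ler_pdivlMr//.
    exact: floor_le_tmp.
  have [k _ Kz] : (\bigcup_k thicken N theta (K (pickle j, k))) z.
    by apply: contrapT => nK; apply: nZ; apply: ZP; exists (pickle j).
  exists (pickle (pickle j, k)); rewrite /D /c pickleK/=; split => //; split => //=.
  rewrite in_itv/= levE -{2}(mul1r d) -mulrDl -ltr_pdivrMr//.
  by have := floorD1_gt (fb z / d); rewrite intrD.
have [q' Eq'] : exists q, E q z.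
  have : (\bigcup_q E q) z by rewrite /E -seqDU_bigcup_eq; exists q.
  by move=> [q' _ ?]; exists q'.
rewrite ((TP z).1 _ Eq').
have [Kz [_ /=]] := ED _ _ Eq'; rewrite in_itv/= => fbz.
have [Kq _] := (SP (c q')).2 z Kz.
have [_ /(_ _ Kq)[_ /=]] := KP (c q'); rewrite in_itv/= andbT => h; lra.
Qed.

End transport.

(** * Worst-case expectations, probabilities and CVaR *)

Section min_attained.
Context (R : realType) (eps : R) (eps_gt0 : 0 < eps) (F : R -> \bar R).
Hypothesis F_ge0 : forall b, (0 <= F b)%E.
Hypothesis F_noninc : forall b b', b <= b' -> (F b' <= F b)%E.
Hypothesis F_lip : forall b b', b <= b' -> (F b <= F b' + (b' - b)%:E)%E.
Hypothesis F_left : exists M p : R, [/\ 0 <= M, eps < p &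
  forall b, (((- M - b) * p)%:E <= F b)%E].

(** The objective is continuous, and at least 1 outside a compact interval because [F] grows to the
    left with slope above [eps]. The premise puts its infimum at most 0, so the minimum over the
    interval is global. *)
Lemma rockafellar_uryasev_min_le0 :
  (forall e : R, 0 < e -> exists b, (b%:E + eps^-1%:E * F b < e%:E)%E) ->
  min_le0 (fun b => (b%:E + eps^-1%:E * F b)%E).
Proof.
move=> h; have ei0 : 0 < eps^-1 by rewrite invr_gt0.
have [b0 b0P] := h 1 ltr01.
have F0 : (F b0 < +oo)%E.
  rewrite ltey; apply: contraTneq b0P => ->.
  by rewrite mulry gtr0_sg// mul1e addey// -leNgt leey.
have Ffin b : F b \is a fin_num.
  rewrite ge0_fin_numE//; have [bb|/ltW bb] := leP b b0.
    by apply: (le_lt_trans (F_lip bb)); rewrite lte_add_pinfty// ltry.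
  by apply: le_lt_trans F0; exact: F_noninc.
pose phi b := fine (F b).
have FE b : F b = (phi b)%:E by rewrite fineK.
pose hr b := b + eps^-1 * phi b.
have hE b : (b%:E + eps^-1%:E * F b)%E = (hr b)%:E by rewrite FE.
have phi_noninc b b' : b <= b' -> phi b' <= phi b.
  by move=> bb; have := F_noninc bb; rewrite !FE lee_fin.
have phi_lip b b' : b <= b' -> phi b <= phi b' + (b' - b).
  by move=> bb; have := F_lip bb; rewrite !FE lee_fin.
have phi_ge0 b : 0 <= phi b by exact: fine_ge0.
have cphi : continuous phi.
  move=> x; apply/(@cvgrPdist_lt _ _ _ (nbhs x)) => e e0.
  have : nbhs x [set y | `|x - y| < e].
    by rewrite -filter_from_norm_nbhs; exists e.
  apply: filterS => y /= xy; apply: le_lt_trans xy.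
  have [xy|/ltW xy] := leP x y.
    have := phi_noninc _ _ xy; have := phi_lip _ _ xy => h1 h2.
    by rewrite ger0_norm ?subr_ge0// distrC ger0_norm ?subr_ge0//; lra.
  have := phi_noninc _ _ xy; have := phi_lip _ _ xy => h1 h2.
  by rewrite distrC ger0_norm ?subr_ge0// ger0_norm ?subr_ge0//; lra.
have chr : continuous hr.
  move=> x; apply: (@cvgD _ _ _ (nbhs x) _ id (fun b => eps^-1 * phi b)).
    exact: cvg_id.
  apply: (@cvgMr _ _ (nbhs x)); exact: cphi.
have [M [p [M0 ep FM]]] := F_left.
have pe : 0 < p / eps - 1 by rewrite subr_gt0 ltr_pdivlMr// mul1r.
(* The value at which the lower bound [b + (- M - b) p / eps] equals 1 for [b = - L]. *)
pose L := (1 + M * (p / eps)) / (p / eps - 1).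
have p0 : 0 < p by exact: lt_trans ep.
have L0 : 0 <= L.
  by rewrite divr_ge0 ?(ltW pe)// addr_ge0// mulr_ge0// divr_ge0// ltW.
have hr_right b : 1 <= b -> 1 <= hr b.
  by move=> b1; rewrite /hr ler_wpDr// mulr_ge0// ltW.
have hr_left b : b <= - L -> 1 <= hr b.
  move=> bL; have h1 : eps^-1 * ((- M - b) * p) <= eps^-1 * phi b.
    by rewrite ler_pM2l// -lee_fin -FE.
  have : L * (p / eps - 1) <= - b * (p / eps - 1) by rewrite ler_pM2r// lerNr.
  rewrite {1}/L divfK ?gt_eqF// => h2.
  have h3 : eps^-1 * ((- M - b) * p) = - M * (p / eps) - b * (p / eps) by ring.
  rewrite h3 mulNr in h1; rewrite mulrBr mulr1 mulNr opprK in h2; rewrite /hr.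
  move: h1 h2; set u := M * _; set v := b * _; set w := _ * phi b; clearbody u v w => h1 h2; lra.
have L1 : - L <= 1 by lra.
have [c cL cmin] := EVT_min L1 (continuous_subspaceT chr).
have inL b : hr b < 1 -> b \in `[- L, 1].
  move=> hb; rewrite in_itv/=; apply/andP; split; rewrite leNgt; apply/negP => /ltW.
    by move=> /hr_left; rewrite leNgt hb.
  by move=> /hr_right; rewrite leNgt hb.
have cb b : hr c <= hr b.
  have [hb|hb] := ltP (hr b) 1; first exact: cmin (inL _ hb).
  rewrite hE lte_fin in b0P.
  by apply: le_trans hb; apply: le_trans (ltW b0P); exact: cmin (inL _ b0P).
exists c => [b|]; rewrite !hE lee_fin//.
apply/ler_addgt0Pr => e /h[b]; rewrite hE lte_fin add0r => /ltW.
exact: le_trans.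
Qed.

End min_attained.

(** * Mean excess over a level *)

Section excess.
Context d (T : measurableType d) (R : realType) (P : probability T R).
Context (Xi : set T) (mXi : measurable Xi) (P_Xi : P Xi = 1%E).
Context (f : T -> R) (mf : measurable_fun Xi f).

(** The common ingredient of the hinge loss, where [b] is 0, and of the CVaR objective. *)
Definition excess (b : R) : \bar R := (\int[P]_(x in Xi) (Num.max (f x - b) 0)%:E)%E.

Lemma measurable_excess b : measurable_fun Xi (fun x => (Num.max (f x - b) 0 : R)%:E).
Proof.
apply/measurable_EFinP; apply: measurable_maxr; last exact: measurable_cst.
by apply: measurable_funB => //; exact: measurable_cst.
Qed.

Lemma excess_ge0 b : (0 <= excess b)%E.
Proof. by apply: integral_ge0 => x _; rewrite lee_fin le_max lexx orbT. Qed.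

Lemma excess_noninc b b' : b <= b' -> (excess b' <= excess b)%E.
Proof.
move=> bb; apply: ge0_le_integral => //; [|exact: measurable_excess..|].
  by move=> x _; rewrite lee_fin le_max lexx orbT.
move=> x _; rewrite lee_fin ge_max !le_max lexx orbT andbT.
by rewrite lerB.
Qed.

Lemma excess_lip b b' : b <= b' -> (excess b <= excess b' + (b' - b)%:E)%E.
Proof.
move=> bb.
have -> : (b' - b)%:E = (\int[P]_(x in Xi) (b' - b)%:E)%E.
  by rewrite integral_cst// [X in (_ * X)%E]P_Xi mule1.
rewrite -ge0_integralD//; last 3 first.
- by move=> x _; rewrite lee_fin le_max lexx orbT.
- exact: measurable_excess.
- by move=> x _; rewrite lee_fin subr_ge0.
apply: ge0_le_integral => //.
- by move=> x _; rewrite lee_fin le_max lexx orbT.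
- exact: measurable_excess.
- by apply: emeasurable_funD; [exact: measurable_excess|exact: measurable_cst].
- move=> x _; rewrite -EFinD lee_fin ge_max; apply/andP; split.
    by rewrite -lerBlDr le_max; apply/orP; left; lra.
  by rewrite addr_ge0 ?subr_ge0// le_max lexx orbT.
Qed.

(** The sets where [f >= - n] exhaust [Xi], so one has mass [p] above [eps]; integrating over it
    alone gives the linear bound. *)
Lemma excess_left (eps : R) : eps < 1 ->
  exists M p : R, [/\ 0 <= M, eps < p & forall b, (((- M - b) * p)%:E <= excess b)%E].
Proof.
move=> eps1.
pose S n := Xi `&` f @^-1` `[- n%:R, +oo[.
have mS n : measurable (S n) by apply: mf => //; exact: measurable_itv.
have SXi : \bigcup_n S n = Xi.
  apply/seteqP; split=> [x [n _ []]//|x Xx].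
  exists (Num.truncn `|f x|).+1 => //; split => //=; rewrite in_itv/= andbT.
  by rewrite lerNl (le_trans (ler_norm _))// normrN ltW// truncnS_gt.
have cS : P (S n) @[n --> \oo] --> P (\bigcup_n S n).
  apply: nondecreasing_cvg_mu => //; first by rewrite SXi.
  apply/nondecreasing_seqP => n; apply/subsetPset => x [Xx]; rewrite /= in_itv/= andbT.
  by move=> fx; split => //=; rewrite in_itv/= andbT (le_trans _ fx)// lerN2 ler_nat.
have [n Sn] : exists n, (eps%:E < P (S n))%E.
  apply: contrapT => /forallNP nS; have : (1 <= eps%:E)%E.
    rewrite -P_Xi -SXi -(cvg_lim _ cS)//; apply: lime_le.
      by apply/cvg_ex; eexists; exact: cS.
    by apply: nearW => k; rewrite leNgt; apply/negP; exact: nS.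
  by rewrite lee_fin leNgt eps1.
exists n%:R, (fine (P (S n))); split => //.
  by rewrite -lte_fin fineK ?fin_num_measure.
move=> b; have [nb|nb] := leP (- n%:R - b) 0.
  apply: le_trans (excess_ge0 b); rewrite lee_fin mulr_le0_ge0//.
  exact: fine_ge0.
apply: (@le_trans _ _ (\int[P]_(x in S n) (- n%:R - b)%:E)%E).
  by rewrite integral_cst// EFinM fineK ?fin_num_measure.
apply: (@le_trans _ _ (\int[P]_(x in S n) (Num.max (f x - b) 0)%:E)%E).
  apply: ge0_le_integral => //.
  - by move=> x _; rewrite lee_fin ltW.
  - by apply: measurable_funS (measurable_excess b) => // x [].
  - move=> x [_]; rewrite /= in_itv/= andbT => fx.
    by rewrite lee_fin le_max lerD2r fx.
apply: ge0_subset_integral => //; first exact: measurable_excess.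
  by move=> x _; rewrite lee_fin le_max lexx orbT.
by move=> x [].
Qed.

End excess.

Section excess_tail.
Context d (T : measurableType d) (R : realType) (P : probability T R).
Context (Xi : set T) (mXi : measurable Xi).
Context (f : T -> R) (mf : measurable_fun Xi f).

(** The layer-cake formula. The random variable is the positive part extended by 0 off [Xi], which
    leaves its tails at levels [r >= 0] inside [Xi]. *)
Lemma excess_ccdf (b : R) : exists2 X : {RV P >-> R},
  excess P Xi f b = (\int[lebesgue_measure]_(r in `[0%R, +oo[) ccdf X r)%E &
  forall r, 0 <= r -> ccdf X r = P (Xi `&` [set x | b + r < f x]).
Proof.
pose h x := Num.max (f x - b) 0 : R.
have mh : measurable_fun setT (h \_ Xi).
  apply/(measurable_restrictT h mXi); apply/measurable_EFinP.
  exact: (measurable_excess mf b).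
pose X : {RV P >-> R} := mfun_Sub (mem_set mh).
have h0 x : 0 <= X x.
  by rewrite /= patchE; case: ifP => // _; rewrite /h le_max lexx orbT.
exists X.
  rewrite -ge0_expectation_ccdf// expectation_def /excess integral_mkcond.
  by apply: eq_integral => x _; rewrite /= !patchE; case: ifP.
move=> r r0; rewrite /ccdf /distribution/= /pushforward; congr (P _).
apply/seteqP; split => x /=; rewrite in_itv/= andbT patchE.
  case: ifPn => [/set_mem Xx|_]; last by rewrite ltNge r0.
  rewrite /h lt_max [r < 0]ltNge r0 orbF => rf; split => //.
  by rewrite addrC -ltrBrDr.
move=> [Xx rf]; rewrite ifT ?inE// /h lt_max; apply/orP; left.
by rewrite ltrBrDr addrC.
Qed.

End excess_tail.

Lemma le_excess d (T : measurableType d) (R : realType) (P P' : probability T R)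
    (Xi : set T) (f f' : T -> R) (b : R) : measurable Xi ->
  measurable_fun Xi f -> measurable_fun Xi f' ->
  (forall a, (P (Xi `&` [set x | (a < f x)%R]) <= P' (Xi `&` [set x | (a < f' x)%R]))%E) ->
  (excess P Xi f b <= excess P' Xi f' b)%E.
Proof.
move=> mXi mf mf' PP.
have [X -> XP] := excess_ccdf P mXi mf b.
have [X' -> XP'] := excess_ccdf P' mXi mf' b.
apply: ge0_le_integral => //.
- by apply: measurable_funS (ccdf_measurable X).
- by apply: measurable_funS (ccdf_measurable X').
- by move=> r; rewrite /= in_itv/= andbT => r0; rewrite XP// XP'.
Qed.

(** * Worst cases of a single loss *)

Section worst_case.
Context (R : realType) (m : nat) (N : 'rV[R]_m -> R) (N_norm : is_norm N).
Context (theta : R) (theta_ge0 : 0 <= theta).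
Context (Xi : set (borelV R m)) (mXi : measurable Xi).
Context (Pz : probability (borelV R m) R) (Pz_Xi : Pz Xi = 1%E).
Context (f fb : borelV R m -> R).
Context (mf : measurable_fun Xi f) (mfb : measurable_fun Xi fb).
Context (f_le : forall z x, Xi z -> Xi x -> N (x - z) <= theta -> f x <= fb z).
Context (f_att : forall z, Xi z -> exists x, [/\ Xi x, N (x - z) <= theta & f x = fb z]).
Implicit Type P : probability (borelV R m) R.

Let mgt (h : borelV R m -> R) a : measurable_fun Xi h ->
  measurable (Xi `&` [set x | (a < h x)%R]).
Proof.
move=> mh; rewrite (_ : [set x | _] = h @^-1` `]a, +oo[).
  by apply: mh => //; exact: measurable_itv.
by apply/seteqP; split => x /=; rewrite in_itv/= andbT.
Qed.

Let mle (h : borelV R m -> R) a : measurable_fun Xi h ->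
  measurable (Xi `&` [set x | (h x <= a)%R]).
Proof.
move=> mh; rewrite (_ : [set x | _] = h @^-1` `]-oo, a]).
  by apply: mh => //; exact: measurable_itv.
by apply/seteqP; split => x /=; rewrite in_itv.
Qed.

(** A point of [Xi] within [theta] of a point where [f] exceeds [a] has [fb] above [a], so the
    thickening bound applies. *)
Lemma ambiguity_tail_le P a : ambiguity_set N Xi Pz theta P ->
  (P (Xi `&` [set x | (a < f x)%R]) <= Pz (Xi `&` [set x | (a < fb x)%R]))%E.
Proof.
move=> [PXi PW]; apply: (wasserstein_le_borel N_norm PW mXi Pz_Xi); [exact: mgt..|].
move=> z [[x [Xx /= ax] xz] Xz]; split => //=.
exact: lt_le_trans ax (f_le Xz Xx xz).
Qed.

Lemma probability_le_gt P (h : borelV R m -> R) a : P Xi = 1%E ->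
  measurable_fun Xi h ->
  P (Xi `&` [set x | (h x <= a)%R]) = (1 - P (Xi `&` [set x | (a < h x)%R]))%E.
Proof.
move=> PXi mh.
rewrite [X in P X](_ : _ = Xi `\` (Xi `&` [set x | a < h x])).
  rewrite measureD//; [|exact: mgt|by rewrite ltey_eq fin_num_measure].
  by rewrite setIA setIid [X in (X - _)%E]PXi.
apply/seteqP; split => x [Xx hx]; split => //.
  by move=> [_ /=]; rewrite ltNge hx.
by rewrite /= leNgt; apply/negP => ?; exact: hx.
Qed.

Lemma ambiguity_safe_ge P a : ambiguity_set N Xi Pz theta P ->
  (Pz (Xi `&` [set x | (fb x <= a)%R]) <= P (Xi `&` [set x | (f x <= a)%R]))%E.
Proof.
move=> amb; have [PXi _] := amb.
by rewrite !probability_le_gt// leeB//; exact: ambiguity_tail_le.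
Qed.

Lemma ambiguity_excess_le P b : ambiguity_set N Xi Pz theta P ->
  (excess P Xi f b <= excess Pz Xi fb b)%E.
Proof. by move=> amb; apply: le_excess => // a; exact: ambiguity_tail_le. Qed.

(** One [P] serves all [a] and [b] simultaneously; this is what later permits exchanging the
    supremum over [P] with the infimum over [beta]. *)
Lemma almost_worst_distribution (d : R) : 0 < d ->
  exists P, [/\ ambiguity_set N Xi Pz theta P,
    forall b, (excess Pz Xi fb (b + d) <= excess P Xi f b)%E &
    forall a, (P (Xi `&` [set x | (f x <= a)%R]) <= Pz (Xi `&` [set x | (fb x <= a + d)%R]))%E].
Proof.
move=> d0.
have [T [mT TN TXi [Z [mZ Z0 TZ]]]] :=
  almost_worst_transport N_norm theta_ge0 mXi Pz_Xi mf mfb f_le f_att d0.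
have [P Pamb PE] := law_in_ambiguity_set N_norm mXi Pz_Xi mT TN TXi.
have mTXi : measurable (T @^-1` Xi) by have := mT measurableT _ mXi; rewrite setTI.
have XiT : Xi `<=` T @^-1` Xi by [].
exists P; split => // [b|a].
  rewrite /excess PE ge0_integral_pushforward//; last 2 first.
  - exact: measurable_excess.
  - by move=> x _; rewrite lee_fin le_max lexx orbT.
  have mfT : measurable_fun Xi (f \o T).
    apply: (measurable_comp mXi _ mf); first by move=> _ [z Xz <-]; exact: TXi.
    exact: measurable_funS mT.
  apply: (@le_trans _ _ (excess Pz Xi (f \o T) b)).
    apply: ae_ge0_le_integral => //.
    - by move=> x _; rewrite lee_fin le_max lexx orbT.
    - exact: measurable_excess.
    - by move=> x _; rewrite lee_fin le_max lexx orbT.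
    - exact: measurable_excess.
    - exists Z; split => // z /=; apply: contra_notP => nZ Xz.
      have := TZ z Xz nZ => fz.
      rewrite lee_fin ge_max !le_max lexx orbT andbT; apply/orP; left.
      by rewrite /=; lra.
  apply: ge0_subset_integral => //.
  - apply: (@measurable_excess _ _ _ (T @^-1` Xi) (f \o T)).
    apply: (measurable_comp mXi _ mf); first by move=> _ [z Xz <-].
    exact: measurable_funS mT.
  - by move=> x _; rewrite lee_fin le_max lexx orbT.
rewrite PE /pushforward.
have mS : measurable (T @^-1` (Xi `&` [set x | f x <= a])).
  by have := mT measurableT _ (mle a mf); rewrite setTI.
rewrite -(probability_setI_full mS mXi Pz_Xi).
apply: (@le_trans _ _ (Pz ((Xi `&` [set x | fb x <= a + d]) `|` Z))).
  apply: le_measure; rewrite ?inE; [exact: measurableI|by apply: measurableU => //; exact: mle|].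
  move=> z [[_ /= fz] Xz]; have [Zz|nZ] := pselect (Z z); [by right|left].
  by split => //=; have := TZ z Xz nZ; lra.
apply: (le_trans (measureU2 _ (mle _ mfb) mZ)).
by rewrite [X in (_ + X <= _)%E]Z0 adde0.
Qed.

(** The shift of the level by [e] costs at most [e], since the excess is 1-Lipschitz in [b]. *)
Lemma worst_excess b :
  ereal_sup [set excess P Xi f b | P in ambiguity_set N Xi Pz theta] = excess Pz Xi fb b.
Proof.
apply/eqP; rewrite eq_le; apply/andP; split.
  by apply: ge_ereal_sup => _ [P amb <-]; exact: ambiguity_excess_le.
apply/lee_addgt0Pr => e e0; have [P [amb Pe _]] := almost_worst_distribution e0.
have be : b <= b + e by rewrite lerDl ltW.
apply: (le_trans (excess_lip mXi Pz_Xi mfb be)); rewrite [b + e - b]addrAC subrr add0r.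
rewrite leeD2r//; apply: (le_trans (Pe b)).
by apply: ereal_sup_ubound; exists P.
Qed.

(** The slack in the level [a] vanishes in the limit by continuity of [Pz] along decreasing sets. *)
Lemma worst_safe a :
  ereal_inf [set P (Xi `&` [set x | (f x <= a)%R]) | P in ambiguity_set N Xi Pz theta] =
  Pz (Xi `&` [set x | (fb x <= a)%R]).
Proof.
apply/eqP; rewrite eq_le; apply/andP; split; last first.
  by apply: le_ereal_inf_tmp => _ [P amb <-]; exact: ambiguity_safe_ge.
pose S n := Xi `&` [set x | fb x <= a + n.+1%:R^-1].
have mS n : measurable (S n) by exact: mle.
have cS : Pz (S n) @[n --> \oo] --> Pz (\bigcap_n S n).
  apply: nonincreasing_cvg_mu => //.
  - by rewrite ltey_eq fin_num_measure.
  - exact: bigcap_measurable.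
  - apply/nonincreasing_seqP => k; apply/subsetPset => z [Xz /= fz]; split => //=.
    by apply: (le_trans fz); rewrite lerD2l lef_pV2 ?posrE// ler_nat.
have -> : Xi `&` [set x | fb x <= a] = \bigcap_n S n.
  apply/seteqP; split => [z [Xz /= fz] n _|z h].
    by split => //=; apply: (le_trans fz); rewrite lerDl.
  split; first by have [] := h 0%N I.
  apply/ler_addgt0Pr => e e0; have [n] := ltr_add_invr e0; rewrite add0r => /ltW ne.
  by have [_ /= /le_trans] := h n I; apply; rewrite lerD2l.
rewrite -(cvg_lim _ cS)//; apply: lime_ge; first by apply/cvg_ex; eexists; exact: cS.
apply: nearW => n; have [|P [amb _ Pn]] := @almost_worst_distribution n.+1%:R^-1.
  by rewrite invr_gt0.
by apply: le_trans (Pn a); apply: ereal_inf_lbound; exists P.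
Qed.

Lemma worst_cvar_le0 (eps : R) : 0 < eps -> eps < 1 ->
  (ereal_sup [set ereal_inf (range (fun b => (b%:E + eps^-1%:E * excess P Xi f b)%E))
    | P in ambiguity_set N Xi Pz theta] <= 0)%E <->
  min_le0 (fun b => (b%:E + eps^-1%:E * excess Pz Xi fb b)%E).
Proof.
move=> eps0 eps1; have ei0 : 0 < eps^-1 by rewrite invr_gt0.
split=> [h|[b _ hb]]; last first.
  apply: ge_ereal_sup => _ [P amb <-]; apply: le_trans hb.
  apply: (@le_trans _ _ (b%:E + eps^-1%:E * excess P Xi f b)%E).
    by apply: ereal_inf_lbound; exists b.
  by rewrite leeD2l// lee_wpmul2l ?lee_fin ?(ltW ei0)//; exact: ambiguity_excess_le.
apply: rockafellar_uryasev_min_le0 => //.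
- by move=> b; exact: excess_ge0.
- by move=> b b'; exact: excess_noninc.
- by move=> b b'; exact: excess_lip.
- exact: excess_left.
(* One half of [e] pays for the shift of beta, the other for choosing beta near the infimum for
   [P]. *)
move=> e e0; have d0 : 0 < e / 2 by exact: divr_gt0.
have [P [amb Pd _]] := almost_worst_distribution d0.
have : (ereal_inf (range (fun b => b%:E + eps^-1%:E * excess P Xi f b)) < (e / 2)%:E)%E.
  apply: (@le_lt_trans _ _ 0%E); last by rewrite lte_fin.
  by apply: le_trans h; apply: ereal_sup_ubound; exists P.
move=> /ereal_inf_lt[_ [b _ <-]] hb; exists (b + e / 2).
apply: (@le_lt_trans _ _ ((e / 2)%:E + (b%:E + eps^-1%:E * excess P Xi f b))%E).
  by rewrite addeA -EFinD [e / 2 + b]addrC leeD2l// lee_wpmul2l ?lee_fin ?(ltW ei0)//.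
by rewrite [X in (_ < X%:E)%E](splitr e) EFinD lteD2lE.
Qed.

End worst_case.

(** * Reduction of the family of losses to its maximum *)

Section max_family.
Context (R : realType) (I : nat) (I_gt0 : (0 < I)%N).
Implicit Types h : 'I_I -> R.

(** Starting from a member of the family keeps the maximum real. *)
Definition max_family h := \big[Num.max/h (Ordinal I_gt0)]_(i < I) h i.

Lemma max_family_ge h i : h i <= max_family h.
Proof. exact: le_bigmax. Qed.

Lemma max_family_attained h : exists i, max_family h = h i.
Proof.
rewrite /max_family; elim/big_ind: _ => [|_ _ [i ->] [j ->]|i _].
- by exists (Ordinal I_gt0).
- by rewrite /Num.max /Order.max; case: ifP => _; [exists j|exists i].
- by exists i.
Qed.

Lemma max_family_le h a : (max_family h <= a) <-> (forall i, h i <= a).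
Proof.
split=> [ha i|ha]; first exact: le_trans (max_family_ge h i) ha.
by have [i ->] := max_family_attained h.
Qed.

(** A nondecreasing map commutes with a finite maximum; hence positive parts may be taken before or
    after the maximum, and the two forms of the CVaR objective agree. *)
Lemma bigmaxe_max_family (phi : R -> R) h : {homo phi : a b / a <= b} ->
  (\big[maxe/-oo]_(i < I) (phi (h i))%:E)%E = (phi (max_family h))%:E.
Proof.
move=> phi_nd; apply/eqP; rewrite eq_le; apply/andP; split.
  apply: bigmax_le => [|i _]; first exact: leNye.
  by rewrite lee_fin; apply: phi_nd; exact: max_family_ge.
have [i ->] := max_family_attained h.
exact: (le_bigmax _ (fun i => (phi (h i))%:E) i).
Qed.

Lemma measurable_max_family d (T : measurableType d) (D : set T)
    (h : 'I_I -> T -> R) : (forall i, measurable_fun D (h i)) ->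
  measurable_fun D (fun t => max_family (h^~ t)).
Proof.
move=> mh; rewrite /max_family.
elim: (index_enum _) => [|i s IH].
  by under eq_fun do rewrite big_nil; exact: mh.
by under eq_fun do rewrite big_cons; apply: measurable_maxr.
Qed.

End max_family.

Lemma sup_attained (R : realType) (A : set R) a : A a -> ubound A a -> sup A = a.
Proof.
move=> Aa Aub; apply/eqP; rewrite eq_le; apply/andP; split.
  by apply: ge_sup => //; exists a.
by apply: ub_le_sup => //; exists a.
Qed.

Section objectives.
Context (R : realType) (n m I : nat) (I_gt0 : (0 < I)%N) (Xi : set 'rV[R]_m).
Context (g : 'I_I -> 'rV[R]_n -> 'rV[R]_m -> R) (x : 'rV[R]_n).
Context (P : probability (borelV R m) R).

Definition max_loss (xi : borelV R m) : R := max_family I_gt0 (fun i => g i x xi).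

Lemma hinge_lossE : hinge_loss Xi g P x = excess P Xi max_loss 0.
Proof.
apply: eq_integral => xi _; rewrite subr0.
rewrite (bigmaxe_max_family I_gt0 (phi := fun a => Num.max a 0))// => a b ab.
by rewrite ge_max !le_max ab lexx orbT.
Qed.

Lemma safe_probE :
  safe_prob Xi g P x = P (Xi `&` [set xi : borelV R m | (max_loss xi <= 0)%R]).
Proof.
congr (P _); apply/seteqP; split => xi [Xx gx]; split => //=.
  by apply/max_family_le.
by move/max_family_le : gx.
Qed.

Lemma cvar_obj_max_posE eps : cvar_obj_max_pos Xi eps g P x =
  (fun b => (b%:E + eps^-1%:E * excess P Xi max_loss b)%E).
Proof.
apply/funext => b; rewrite /cvar_obj_max_pos; congr (_ + _)%E; congr (_ * _)%E.
apply: eq_integral => xi _.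
rewrite (bigmaxe_max_family I_gt0 (phi := fun a => Num.max (a - b) 0))// => a a' aa.
by rewrite ge_max !le_max lerD2r aa lexx orbT.
Qed.

Lemma cvar_obj_pos_maxE eps : cvar_obj_pos_max Xi eps g P x =
  (fun b => (b%:E + eps^-1%:E * excess P Xi max_loss b)%E).
Proof.
apply/funext => b; rewrite /cvar_obj_pos_max; congr (_ + _)%E; congr (_ * _)%E.
apply: eq_integral => xi _.
by rewrite (bigmaxe_max_family I_gt0 (phi := id))// -EFinB -EFin_max.
Qed.

End objectives.

Theorem proposition9 (R : realType) (n m I : nat) (I_gt0 : (0 < I)%N)
  (N : 'rV[R]_m -> R) (N_norm : is_norm N)
  (Xi : set 'rV[R]_m) (Xi_meas : measurable (Xi : set (borelV R m)))
  (X : set 'rV[R]_n) (X_nonempty : X !=set0) (X_closed : closed X)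
  (X_convex : convex_set (X : set (convex_lmodType 'rV[R]_n)))
  (X_cone : exists2 K : set 'rV[R]_n, closed_pointed_convex_cone K & X `<=` K)
  (c : 'rV[R]_n) (eps theta : R)
  (eps_gt0 : 0 < eps) (eps_lt1 : eps < 1) (theta_ge0 : 0 <= theta)
  (g : 'I_I -> 'rV[R]_n -> 'rV[R]_m -> R)
  (g_convex : forall i xi, Xi xi ->
     convex_function (setT : set (convex_lmodType 'rV[R]_n))
       (fun x => g i x xi))
  (g_lsc : forall i xi, Xi xi ->
     lower_semicontinuous (fun x : 'rV[R]_n => (g i x xi)%:E))
  (g_meas : forall i x, X x ->
     measurable_fun (Xi : set (borelV R m)) (g i x : borelV R m -> R))
  (Pz : probability (borelV R m) R) (Pz_Xi : Pz Xi = 1%E)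
  (Pz_subgauss : exists C1 C2 : R, [/\ 0 < C1, 0 < C2
     & forall r : R, 0 <= r ->
         (Pz [set z : borelV R m | (r <= N z)%R] <=
          (C1 * expR (- C2 * r ^+ 2))%:E)%E])
  (gbar_attained : forall i x zeta, X x -> Xi zeta ->
     exists xi, [/\ Xi xi, N (xi - zeta) <= theta
       & forall xi', Xi xi' -> N (xi' - zeta) <= theta ->
           g i x xi' <= g i x xi])
  (gbar_meas : forall i x, X x ->
     measurable_fun (Xi : set (borelV R m))
       (gbar Xi N theta g i x : borelV R m -> R)) :
  let amb := ambiguity_set N Xi Pz theta in
  let gb := gbar Xi N theta g in
  (let S := alsox_feasible X c eps
       (worst_hinge_loss Xi g amb) (worst_safe_prob Xi g amb) in
   let S' := alsox_feasible X c eps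
       (hinge_loss Xi gb Pz) (safe_prob Xi gb Pz) in
   S = S' /\ alsox_value S = alsox_value S')
  /\
  (let S := [set x | X x /\ (worst_cvar Xi eps g amb x <= 0)%E] in
   let S' := [set x | X x /\ min_le0 (cvar_obj_pos_max Xi eps gb Pz x)] in
   S = S' /\ linear_value c S = linear_value c S').
Proof.
move=> amb gb.
pose f x := max_loss I_gt0 g x; pose fb x := max_loss I_gt0 gb x.
have gbE i x z : X x -> Xi z -> exists xi, [/\ Xi xi, N (xi - z) <= theta & g i x xi = gb i x z].
  move=> Xx Xz; have [xi [Xxi xiz xi_max]] := gbar_attained i x z Xx Xz.
  exists xi; split => //; rewrite /gb /gbar (@sup_attained _ _ (g i x xi))//.
    by exists xi.
  by move=> _ [xi' [Xxi' xiz'] <-]; exact: xi_max.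
have gb_ge i x z xi : X x -> Xi z -> Xi xi -> N (xi - z) <= theta -> g i x xi <= gb i x z.
  move=> Xx Xz Xxi xiz; apply: ub_le_sup; last by exists xi.
  have [xi0 [_ _ xi_max]] := gbar_attained i x z Xx Xz.
  by exists (g i x xi0) => _ [xi' [Xxi' xiz'] <-]; exact: xi_max.
have mf x : X x -> measurable_fun (Xi : set (borelV R m)) (f x).
  by move=> Xx; apply: measurable_max_family => i; exact: g_meas.
have mfb x : X x -> measurable_fun (Xi : set (borelV R m)) (fb x).
  by move=> Xx; apply: measurable_max_family => i; exact: gbar_meas.
have f_le x : X x -> forall z xi, Xi z -> Xi xi -> N (xi - z) <= theta -> f x xi <= fb x z.
  move=> Xx z xi Xz Xxi xiz; apply/max_family_le => i.
  exact: le_trans (gb_ge i x z xi Xx Xz Xxi xiz) (max_family_ge I_gt0 _ i).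
have f_att x : X x -> forall z, Xi z ->
    exists xi, [/\ Xi xi, N (xi - z) <= theta & f x xi = fb x z].
  (* A maximizer for the index attaining the largest [gb i x z] also attains the maximum for the
     whole family. *)
  move=> Xx z Xz; have [i fbi] := max_family_attained I_gt0 (fun i => gb i x z).
  have [xi [Xxi xiz gi]] := gbE i x z Xx Xz; exists xi; split => //.
  apply/eqP; rewrite eq_le f_le//= /fb /max_loss fbi -gi.
  exact: (max_family_ge I_gt0 (fun i => g i x xi)).
have hingeE x : X x -> worst_hinge_loss Xi g amb x = hinge_loss Xi gb Pz x.
  move=> Xx; rewrite (hinge_lossE I_gt0) -(worst_excess N_norm theta_ge0 Xi_meas Pz_Xi
    (mf x Xx) (mfb x Xx) (f_le x Xx) (f_att x Xx)).
  congr ereal_sup; apply: eq_imagel => P _; exact: hinge_lossE.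
have safeE x : X x -> worst_safe_prob Xi g amb x = safe_prob Xi gb Pz x.
  move=> Xx; rewrite (safe_probE I_gt0) -(worst_safe N_norm theta_ge0 Xi_meas Pz_Xi
    (mf x Xx) (mfb x Xx) (f_le x Xx) (f_att x Xx)).
  congr ereal_inf; apply: eq_imagel => P _; exact: safe_probE.
have cvarE x : X x -> (worst_cvar Xi eps g amb x <= 0)%E <->
    min_le0 (cvar_obj_pos_max Xi eps gb Pz x).
  move=> Xx; rewrite (cvar_obj_pos_maxE I_gt0) -(worst_cvar_le0 N_norm theta_ge0 Xi_meas Pz_Xi
    (mf x Xx) (mfb x Xx) (f_le x Xx) (f_att x Xx) eps_gt0 eps_lt1).
  rewrite /worst_cvar.
  by under eq_imagel do rewrite (cvar_obj_max_posE I_gt0).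
split.
  move=> S S'; suff -> : S = S' by [].
  (* The argmin compares points of [X] only, so equality of the objectives on [X] suffices. *)
  apply/seteqP; split => -[t x] [[/= Xx cx xmin]]; rewrite /= => xeps.
    split; last by rewrite -safeE.
    by split => // y Xy cy; rewrite -!hingeE//; exact: xmin.
  split; last by rewrite safeE.
  by split => // y Xy cy; rewrite !hingeE//; exact: xmin.
move=> S S'; suff -> : S = S' by [].
by apply/seteqP; split => x [Xx /(cvarE x Xx)].
Qed.
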